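(* Let $G=(V,E)$ be a graph with vertex set $V=\{1,\ldots,v\}$, $v\geq 2$, and edge set $E=\{\epsilon_1,\ldots,\epsilon_e\}\subseteq\{(i,j):1\leq i<j\leq v\}$ with $e\geq 1$, and let $d$ be the maximal degree of the vertices of $G$. Then as $x\to\infty$, $$\sum_{\substack{a_1,\ldots,a_v\leq x\\ G\text{-wise coprime}}}\frac{1}{a_1\cdots a_v}=P_v(\log x)+O(x^{-1}\log^{v+d-1}x),$$ where $P_v$ is a polynomial of degree $v$ with leading coefficient $\rho(G)>0$.
   Context: A tuple $(a_1,\ldots,a_v)$ of positive integers is $G$-wise coprime if $\gcd(a_i,a_j)=1$ whenever $(i,j)\in E$. For positive integers $m_1,\ldots,m_e$ and each vertex $r$, let $M_r$ be the least common multiple of those $m_i$ for which the edge $\epsilon_i$ contains the vertex $r$ ($M_r=1$ if there are none). Then $\rho(G)=\sum_{m_1,\ldots,m_e=1}^{\infty}\frac{\mu(m_1)\cdots\mu(m_e)}{M_1\cdots M_v}$ (an absolutely convergent series), where $\mu$ is the Möbius function. *)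

(* Defs.v *)
From HB Require Import structures.
From mathcomp Require Export all_boot all_order all_algebra.
From mathcomp Require Export all_classical all_reals all_analysis.

#[export] Set Implicit Arguments.
#[export] Unset Strict Implicit.
#[export] Unset Printing Implicit Defensive.

Export Order.TTheory GRing.Theory Num.Theory.
Export numFieldNormedType.Exports.

Local Open Scope ring_scope.

(* Lets f = g +O_ (+oo_R) h find the filter structure of +oo_R. *)
Canonical pinfty_filter_on (R : numFieldType) :=
  FilterType (pinfty_nbhs R) (@filter_filter _ _ (@proper_pinfty_nbhs R)).

Definition squarefree (n : nat) : bool :=
  (0 < n)%N && all (fun p => logn p n == 1%N) (primes n).

Definition moebius (n : nat) : int :=
  if squarefree n then (-1) ^+ size (primes n) else 0.

Section Graph.
Variable v : nat.

(* A graph on the vertex set 'I_v is given by its set of edges (i, j), i < j. *)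
Implicit Types (E : {set 'I_v * 'I_v}) (r : 'I_v).

Definition is_edge_set E := forall i j, (i, j) \in E -> (i < j)%N.

Definition incident r (p : 'I_v * 'I_v) : bool := (p.1 == r) || (p.2 == r).

Definition degree E r : nat := #|[set p in E | incident r p]|.

Definition max_degree E : nat := \max_(r < v) degree E r.

Definition Gcoprime E (a : 'I_v -> nat) : bool :=
  [forall p in E, coprime (a p.1) (a p.2)].

(* For nonnegative x, the naturals k with k%:R <= x are exactly the elements
   of 'I_(Num.truncn x).+1; for x < 1 there is no admissible tuple. *)
Definition Gcoprime_sum (R : realType) E (x : R) : R :=
  \sum_(a : {ffun 'I_v -> 'I_(Num.truncn x).+1} |
          [forall i, (0 < a i)%N] && Gcoprime E (fun i => a i))
     (\prod_(i < v) (a i)%:R)^-1.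

(* The edges are enumerated as enum_val i, i : 'I_#|E|. *)
Definition edge_lcm E (m : 'I_#|E| -> nat) r : nat :=
  \big[lcmn/1%N]_(i < #|E| | incident r (enum_val i)) m i.

Definition rho_term (R : realType) E (m : {ffun 'I_#|E| -> nat}) : R :=
  (\prod_(i < #|E|) moebius (m i))%:~R / (\prod_(r < v) edge_lcm m r)%N%:R.

Definition pos_tuples E : set {ffun 'I_#|E| -> nat} :=
  [set m | forall i, (0 < m i)%N]%classic.
Arguments pos_tuples : clear implicits.

(* The sum of an absolutely convergent family is the sum of its positive parts
   minus the sum of its negative parts. When absolute convergence fails, the
   value is 0; see rho_gt0_summable. *)
Definition rho (R : realType) E : R :=
  let f m := (rho_term R m)%:E in
  fine (\esum_(m in pos_tuples E) (f^\+ m) - \esum_(m in pos_tuples E) (f^\- m))%E.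

Lemma rho_gt0_summable (R : realType) E :
  0 < rho R E -> summable (pos_tuples E) (fun m => (rho_term R m)%:E).
Proof.
rewrite /rho /=; set f := fun m => (rho_term R m)%:E => rho_gt0.
have p0 : (0 <= \esum_(m in pos_tuples E) f^\+ m)%E by apply: esum_ge0.
have n0 : (0 <= \esum_(m in pos_tuples E) f^\- m)%E by apply: esum_ge0.
rewrite /summable (eq_esum (b := (f^\+ \+ f^\-)%E)); last first.
  by move=> m _; exact: (congr1 (@^~ m) (fune_abse f)).
rewrite esumD //; move: rho_gt0 p0 n0.
case: (\esum_(m in _) f^\+ m)%E => [p||];
  case: (\esum_(m in _) f^\- m)%E => [n||] //=; rewrite ?ltxx //.
by move=> *; rewrite -EFinD ltry.
Qed.

End Graph.

Arguments pos_tuples {v} E.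

(* Main.v *)
(** Expanding the coprimality conditions by Moebius inversion gives
      S(x) = sum_m mu(m_1) ... mu(m_e) / (M_1 ... M_v) * prod_r H(x / M_r),
    where H(y) is the sum of 1 / n over n <= y.  Replacing H(y) by
    ln y + gamma turns the right side into a polynomial in ln x.  The error is
      O(x^-1 ln^(v-1) x) * sum_r sum_m M_r^(1 - d / ln x) / (M_1 ... M_v),
    where Rankin's factor M_r^(- d / ln x) also covers the tuples with some
    M_r > x.  Outside the edges at r the square of the lcm L of the labels is
    at most the product of the lcms at the vertices, so the labels off r
    contribute a convergent sum of tau(L)^e / L^(3/2), while each of the at
    most d labels at r contributes a factor O(ln x).

    The leading coefficient is the sum of the weights, rho(G).  It is positive
    because S(x) >= c ln^v x: among the tuples with all a_i = 1 mod y!, y large,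
    those with a common factor along some edge are in the minority. *)
Require Import Defs.
From mathcomp Require Import ring lra zify.
Local Open Scope ring_scope.

(** * Harmonic sums, Euler's constant and power bounds *)

Section HarmonicSums.
Variable R : realType.
Implicit Types (n N k : nat) (x y t d u : R).

Definition harmonic_sum n : R := \sum_(1 <= k < n.+1) k%:R^-1.

Lemma invr_succ_le_ln n : (0 < n)%N -> n.+1%:R^-1 <= ln n.+1%:R - ln n%:R :> R.
Proof.
move=> n0; have n0' : 0 < n%:R :> R by rewrite ltr0n.
have s0 : 0 < n.+1%:R :> R by rewrite ltr0n.
rewrite -ln_div ?posrE //.
have -> : n.+1%:R / n%:R = (n%:R / n.+1%:R)^-1 :> R by rewrite invf_div.
rewrite lnV ?posrE ?divr_gt0 //.
have -> : n%:R / n.+1%:R = 1 + (- n.+1%:R^-1) :> R.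
  by rewrite -natr1; field; rewrite natr1 gt_eqF.
rewrite lerNr; apply: le_ln1Dx.
by rewrite ltrN2 invf_lt1 // ltr1n.
Qed.

Lemma ln_succ_le_invr n : (0 < n)%N -> ln n.+1%:R - ln n%:R <= n%:R^-1 :> R.
Proof.
move=> n0; have n0' : 0 < n%:R :> R by rewrite ltr0n.
rewrite -ln_div ?posrE ?ltr0n //.
have -> : n.+1%:R / n%:R = 1 + n%:R^-1 :> R.
  by rewrite -natr1; field; rewrite gt_eqF.
by apply: le_ln1Dx; rewrite (lt_trans (@ltrN10 R)) // invr_gt0.
Qed.

Lemma harmonic_sumS n : harmonic_sum n.+1 = harmonic_sum n + n.+1%:R^-1.
Proof. by rewrite /harmonic_sum big_nat_recr. Qed.

Lemma harmonic_sum0 : harmonic_sum 0 = 0.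
Proof. by rewrite /harmonic_sum big_nil. Qed.

Lemma harmonic_sum_ge0 n : 0 <= harmonic_sum n.
Proof. by apply: sumr_ge0 => i _; rewrite invr_ge0 ler0n. Qed.

Lemma harmonic_sub_ln_antimono m n : (0 < m <= n)%N ->
  harmonic_sum n - ln n%:R <= harmonic_sum m - ln m%:R.
Proof.
case/andP => m0; elim: n => [|n IH]; first by case: m m0.
rewrite leq_eqVlt => /predU1P[->//|]; rewrite ltnS => mn.
apply: le_trans (IH mn); rewrite harmonic_sumS.
have := @invr_succ_le_ln n (leq_trans m0 mn).
by move: (_^-1) (ln n.+1%:R) (ln n%:R) => a b c; lra.
Qed.

Lemma harmonic_sub_lnS_mono m n : (m <= n)%N ->
  harmonic_sum m - ln m.+1%:R <= harmonic_sum n - ln n.+1%:R.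
Proof.
elim: n => [|n IH]; first by rewrite leqn0 => /eqP ->.
rewrite leq_eqVlt => /predU1P[->//|]; rewrite ltnS => mn.
apply: le_trans (IH mn) _; rewrite harmonic_sumS.
have := @ln_succ_le_invr n.+1 isT.
by move: (_^-1) (ln n.+1%:R) (ln n.+2%:R) => a b c; lra.
Qed.

(** The constant is the supremum of the increasing sequence [u]. Each [harmonic_sum m - ln m%:R]
    bounds [u n], by comparing both at the larger of the two indices; [u 0 = 0] and
    [harmonic_sum 1 - ln 1 = 1] place the supremum in [0, 1]. *)
Lemma euler_constant_exists : exists2 g : R, 0 <= g <= 1 &
  forall n, (0 < n)%N ->
    harmonic_sum n - ln n.+1%:R <= g <= harmonic_sum n - ln n%:R.
Proof.
pose u n := harmonic_sum n - ln n.+1%:R.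
have ub n m : (0 < m)%N -> u n <= harmonic_sum m - ln m%:R.
  move=> m0; apply: le_trans (harmonic_sub_lnS_mono (leq_maxl n m)) _.
  apply: le_trans (@harmonic_sub_ln_antimono m (maxn n m) _); last first.
    by rewrite m0 leq_maxr.
  rewrite lerD2l lerN2 ler_ln ?posrE ?ltr0n ?ler_nat //.
  by rewrite (leq_trans m0) // leq_maxr.
have hs : has_sup (range u).
  split; first by exists (u 0%N); exists 0%N.
  by exists (harmonic_sum 1 - ln 1%:R) => _ [n _ <-]; apply: ub.
exists (sup (range u)); last first.
  move=> n n0; apply/andP; split; first by apply: ub_le_sup; [case: hs|exists n].
  by apply: ge_sup; [case: hs|move=> _ [k _ <-]; apply: ub].
apply/andP; split.
  apply: le_trans (_ : u 0%N <= _); first by rewrite /u harmonic_sum0 ln1 subr0.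
  by apply: ub_le_sup; [case: hs|exists 0%N].
apply: ge_sup; first by case: hs.
move=> _ [k _ <-]; apply: le_trans (ub k 1%N isT) _.
by rewrite harmonic_sumS harmonic_sum0 ln1 add0r invr1 subr0.
Qed.

Lemma ln_le_harmonic_sum n : ln n.+1%:R <= harmonic_sum n.
Proof.
have := harmonic_sub_lnS_mono (leq0n n).
by rewrite harmonic_sum0 ln1 subr0 subr_ge0.
Qed.

Lemma harmonic_le_ln n : (0 < n)%N -> harmonic_sum n <= 1 + ln n%:R.
Proof.
move=> n0; have := @harmonic_sub_ln_antimono 1 n n0.
by rewrite harmonic_sumS harmonic_sum0 ln1 add0r invr1 subr0 lerBlDr.
Qed.

(** The quotient of the two powers on the right is [expR (d * (ln n.+1%:R - ln n%:R))], at least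
    [1 + d / n.+1%:R]. The right side is shaped to telescope. *)
Lemma powR_succ_le n d : (0 < n)%N -> 0 < d ->
  n.+1%:R `^ (- (1 + d)) <= d^-1 * (n%:R `^ (- d) - n.+1%:R `^ (- d)) :> R.
Proof.
move=> n0 d0; have n0' : 0 < n%:R :> R by rewrite ltr0n.
have s0 : 0 < n.+1%:R :> R by rewrite ltr0n.
rewrite opprD powRD ?(gt_eqF s0) ?implybT // (powR_inv1 (ltW s0)).
rewrite ler_pdivlMl // lerBrDl.
have -> : n%:R `^ (- d) = n.+1%:R `^ (- d) * expR (d * (ln n.+1%:R - ln n%:R)) :> R.
  by rewrite /powR !gt_eqF // -expRD; congr expR; ring.
set a := _ `^ _; have a0 : 0 < a by apply: powR_gt0.
rewrite (_ : a + _ = a * (1 + d * n.+1%:R^-1)); last by ring.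
rewrite ler_pM2l //; apply: le_trans (expR_ge1Dx _).
by rewrite lerD2l ler_pM2l // invr_succ_le_ln.
Qed.

(** The term at 0 vanishes, since 0 to a nonzero power is 0; the term at 1 is 1, and the rest
    telescopes. *)
Lemma sum_powR_le d N : 0 < d -> \sum_(n < N.+1) n%:R `^ (- (1 + d)) <= 1 + d^-1.
Proof.
move=> d0.
have lt1d : - (1 + d) != 0 by rewrite oppr_eq0 gt_eqF // addr_gt0.
case: N => [|N]; first by rewrite big_ord1 powR0 // addr_ge0 // invr_ge0 ltW.
apply: le_trans (_ : 1 + d^-1 * (1 - N.+1%:R `^ (- d)) <= _); last first.
  by rewrite lerD2l -[leRHS]mulr1 ler_pM2l ?invr_gt0 // gerBl powR_ge0.
elim: N => [|N IH].
  rewrite big_ord_recr big_ord1 /= powR0 // powR1 add0r subrr mulr0 addr0; exact: lexx.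
rewrite big_ord_recr /=; apply: le_trans (lerD IH (powR_succ_le _ d0)) _ => //.
rewrite le_eqVlt; apply/orP; left; apply/eqP; ring.
Qed.

(* Raise [1 + u <= K exp (u / K)], with [K = 2 k + 1], to the power [k]. *)
Lemma expr_le_expR k : exists2 C : R, 0 < C &
  forall u, 0 <= u -> (1 + u) ^+ k <= C * expR (u / 2).
Proof.
exists ((2 * k)%N.+1%:R ^+ k); first by rewrite exprn_gt0 // ltr0n.
move=> u u0; set K := (2 * k)%N.+1%:R : R.
have K0 : 0 < K by rewrite ltr0n.
have K1 : 1 <= K by rewrite ler1n.
have H : 1 + u <= K * expR (u / K).
  apply: le_trans (_ : K * (1 + u / K) <= _); last by rewrite ler_pM2l // expR_ge1Dx.
  by rewrite mulrDr mulr1 mulrCA divff ?gt_eqF // mulr1 lerD2r.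
apply: le_trans (_ : (K * expR (u / K)) ^+ k <= _).
  by rewrite lerXn2r // ?nnegrE ?addr_ge0 // mulr_ge0 ?expR_ge0 // ltW.
rewrite exprMn ler_pM2l ?exprn_gt0 // -expRM_natl ler_expR -mulr_natl.
rewrite mulrCA ler_wpM2l // ler_pdivrMr // ler_pdivlMl //.
by rewrite mulr1 /K -natrM ler_nat.
Qed.

End HarmonicSums.

(** * The Moebius function and divisor counts *)

Lemma moebius_prime_mul p n : prime p -> ~~ (p %| n)%N -> (0 < n)%N ->
  moebius (p * n) = - moebius n.
Proof.
move=> pp pn n0; have p0 := prime_gt0 pp.
have E : perm_eq (primes (p * n)) (p :: primes n).
  apply: uniq_perm; rewrite ?primes_uniq //= ?primes_uniq ?andbT.
    by rewrite mem_primes pp n0.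
  by move=> q; rewrite primesM // primes_prime // !inE.
rewrite /moebius /squarefree muln_gt0 p0 n0 /= (perm_all _ E) (perm_size E) /=.
have -> : logn p (p * n) = 1%N.
  by rewrite lognM // logn_prime // eqxx lognE pp n0 (negbTE pn).
rewrite (_ : all _ (primes n) = all (fun q => logn q n == 1%N) (primes n)).
  by rewrite eqxx /=; case: ifP => _; rewrite ?oppr0 // exprS mulN1r.
apply: eq_in_all => q qn; rewrite lognM // logn_prime //.
have [qp|] := eqVneq q p; last by [].
by move: qn; rewrite qp mem_primes (negbTE pn) !andbF.
Qed.

Lemma moebius_prime_sqr_mul p n : prime p -> (p %| n)%N -> moebius (p * n) = 0.
Proof.
move=> pp pn; have p0 := prime_gt0 pp; rewrite /moebius /squarefree.
case: (posnP n) => [->|n0]; first by rewrite muln0.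
case: ifP => // /andP[_ /allP/(_ p)].
rewrite mem_primes pp muln_gt0 p0 n0 dvdn_mulr // => /(_ isT).
by rewrite lognM // logn_prime // eqxx lognE pp n0 pn.
Qed.

(** For [n > 1] with least prime factor [p], a divisor [d] prime to [p] cancels against [p * d];
    divisors that [p] divides twice contribute 0. *)
Lemma sum_moebius_divisors n : (0 < n)%N ->
  \sum_(d <- divisors n) moebius d = (n == 1%N)%:R.
Proof.
move=> n0; have [->|n1] := eqVneq n 1%N.
  by rewrite big_cons big_nil addr0.
have pp : prime (pdiv n) by rewrite pdiv_prime // ltn_neqAle eq_sym n1.
set p := pdiv n in pp; have p0 := prime_gt0 pp; have pn : (p %| n)%N := pdiv_dvd n.
rewrite (bigID (fun d => p %| d)%N) /=.
have <- : - (\sum_(d <- divisors n | ~~ (p %| d)%N) moebius d) =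
    \sum_(d <- divisors n | (p %| d)%N) moebius d; last by rewrite addNr.
rewrite [RHS](bigID (fun d => p %| d %/ p)%N) /= [X in _ = X + _]big1_seq ?add0r; last first.
  by move=> d /andP[/andP[pd pd2] _]; rewrite -(divnK pd) mulnC moebius_prime_sqr_mul.
rewrite -[RHS]big_filter -sumrN -[LHS]big_filter.
rewrite [RHS](perm_big [seq (p * d)%N | d <- [seq d <- divisors n | ~~ (p %| d)%N]]) /=.
  rewrite big_map; apply: eq_big_seq => d; rewrite mem_filter -dvdn_divisors //.
  by case/andP=> pd dn; rewrite moebius_prime_mul // (dvdn_gt0 n0).
apply: uniq_perm; rewrite ?filter_uniq ?divisors_uniq //.
  rewrite map_inj_uniq ?filter_uniq ?divisors_uniq // => a b /eqP.
  by rewrite eqn_pmul2l // => /eqP.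
move=> d; rewrite mem_filter -dvdn_divisors //; apply/idP/mapP.
  case/andP => /andP[pd pd2] dn; exists (d %/ p)%N; last by rewrite mulnC divnK.
  rewrite mem_filter pd2 -dvdn_divisors //=; apply: dvdn_trans dn.
  by rewrite -{2}(divnK pd) dvdn_mulr.
case=> k; rewrite mem_filter -dvdn_divisors // => /andP[pk kn] ->.
rewrite mulKn // dvdn_mulr //= pk /= Gauss_dvd ?pn //.
by rewrite prime_coprime.
Qed.

Lemma perm_divisors n N : (0 < n <= N)%N ->
  perm_eq (divisors n) [seq d <- index_iota 0 N.+1 | (d %| n)%N].
Proof.
case/andP => n0 nN; apply: uniq_perm; rewrite ?filter_uniq ?iota_uniq ?divisors_uniq //.
move=> d; rewrite mem_filter -dvdn_divisors // mem_index_iota ltnS.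
by case dn: (d %| n)%N => //=; rewrite (leq_trans (dvdn_leq n0 dn)).
Qed.

Lemma sum_dvdn_le n N : (0 < n)%N ->
  (\sum_(d < N.+1) (d %| n)%N <= size (divisors n))%N.
Proof.
move=> n0; rewrite -(big_mkord xpredT (fun d => (d %| n)%N : nat)).
rewrite -big_mkcond /= sum1_count -size_filter; apply: uniq_leq_size.
  by rewrite filter_uniq ?iota_uniq.
by move=> d; rewrite mem_filter -dvdn_divisors // => /andP[].
Qed.

(** A divisor [d] is determined by [gcdn d a] and its cofactor in [d]. The cofactor is coprime to
    [a %/ gcdn d a], so it divides [b]. *)
Lemma size_divisors_mul a b : (0 < a)%N -> (0 < b)%N ->
  (size (divisors (a * b)) <= size (divisors a) * size (divisors b))%N.
Proof.
move=> a0 b0; have ab0 : (0 < a * b)%N by rewrite muln_gt0 a0.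
pose f d := (gcdn d a, d %/ gcdn d a)%N.
rewrite -(size_map f) -[X in (_ <= X)%N](size_allpairs pair); apply: uniq_leq_size.
  rewrite map_inj_uniq ?divisors_uniq // => c d [e1 e2].
  by rewrite -(divnK (dvdn_gcdl c a)) -(divnK (dvdn_gcdl d a)) e2 e1.
move=> _ /mapP[d dab ->]; rewrite -dvdn_divisors // in dab.
have d0 := dvdn_gt0 ab0 dab; have g0 : (0 < gcdn d a)%N by rewrite gcdn_gt0 d0.
apply/allpairsP; exists (f d); rewrite -!dvdn_divisors //= dvdn_gcdr; split => //.
have cop : coprime (d %/ gcdn d a) (a %/ gcdn d a).
  rewrite /coprime -(eqn_pmul2r g0) muln_gcdl !divnK ?dvdn_gcdl ?dvdn_gcdr //.
  by rewrite mul1n.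
rewrite -(Gauss_dvdr _ cop) -(dvdn_pmul2r g0) divnK ?dvdn_gcdl // mulnAC.
by rewrite divnK ?dvdn_gcdr.
Qed.

Lemma sum_multiples (V : nmodType) (f : nat -> V) g N : (0 < g)%N ->
  \sum_(n < N.+1 | (g %| n)%N) f n = \sum_(j < (N %/ g).+1) f (g * j)%N.
Proof.
move=> g0; rewrite -(big_mkord (fun n => g %| n)%N f) -big_filter.
rewrite -(big_mkord xpredT (fun j => f (g * j)%N)).
rewrite -(big_map (muln g) xpredT f); apply: perm_big; apply: uniq_perm.
- by rewrite filter_uniq ?iota_uniq.
- by rewrite map_inj_uniq ?iota_uniq // => a b /eqP; rewrite eqn_pmul2l // => /eqP.
move=> n; rewrite mem_filter mem_index_iota ltnS; apply/idP/mapP.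
  case/andP=> gn nN; exists (n %/ g)%N; last by rewrite mulnC divnK.
  by rewrite mem_index_iota ltnS leq_div2r.
case=> j; rewrite mem_index_iota ltnS leq_divRL // mulnC => jN ->.
by rewrite dvdn_mulr.
Qed.

(** * Moments of the divisor function *)

Section DivisorSums.
Variable R : realType.

Definition divisor_moment k N : R :=
  \sum_(n < N.+1) (size (divisors n))%:R ^+ k * n%:R `^ (- (3 / 2)).

Lemma divisor_moment_ge0 k N : 0 <= divisor_moment k N.
Proof. by apply: sumr_ge0 => n _; rewrite mulr_ge0 ?powR_ge0 ?exprn_ge0 ?ler0n. Qed.

(** One factor of the divisor count is spent on counting the pairs with [a * b = n]. As [F] is
    submultiplicative, letting [a] and [b] range freely gives the square. *)
Lemma divisor_momentS k N : divisor_moment k.+1 N <= divisor_moment k N ^+ 2.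
Proof.
pose F n : R := (size (divisors n))%:R ^+ k * n%:R `^ (- (3 / 2)).
have F0 n : 0 <= F n by rewrite mulr_ge0 ?powR_ge0 ?exprn_ge0 ?ler0n.
(* At 0 the divisor count is not a count of factorisations, but its weight vanishes. *)
have Z : F 0%N = 0.
  by rewrite /F powR0 ?mulr0 // oppr_eq0; apply/eqP; lra.
have -> : divisor_moment k.+1 N =
    \sum_(n < N.+1) \sum_(a < N.+1) \sum_(b < N.+1) (a * b == n)%N%:R * F n.
  apply: eq_bigr => n _; rewrite exprS -mulrA -/(F n).
  under eq_bigr do rewrite -big_distrl /=.
  rewrite -big_distrl /=; case: (posnP n) => [->|n0]; first by rewrite Z !mulr0.
  congr (_ * _); rewrite -sum1_size (perm_big _ (@perm_divisors n N _)); last first.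
    by rewrite n0 -ltnS /=.
  rewrite big_filter big_mkord natr_sum big_mkcond; apply: eq_bigr => a _.
  case: ifPn => an.
    have ltb : (n %/ a < N.+1)%N by apply: leq_ltn_trans (leq_div _ _) (ltn_ord n).
    rewrite (bigD1 (Ordinal ltb)) //= mulnC divnK // eqxx big1 ?addr0 // => b bn.
    case: eqP => // abn; case/eqP: bn; apply: val_inj => /=.
    by rewrite -abn mulKn // (dvdn_gt0 n0).
  rewrite big1 // => b _; case: eqP => // abn.
  by rewrite -abn dvdn_mulr in an.
rewrite exchange_big /= expr2 {1}/divisor_moment big_distrl /=.
apply: ler_sum => a _; rewrite exchange_big /= big_distrr /=.
apply: ler_sum => b _; rewrite -/(F a) -/(F b).
apply: le_trans (_ : F (a * b)%N <= _).
  have [abN|abN] := ltnP (a * b)%N N.+1.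
    rewrite (bigD1 (Ordinal abN)) //= eqxx mul1r big1 ?addr0 // => n nab.
    by case: eqP => [e|]; rewrite ?mul0r //; case/eqP: nab; apply: val_inj.
  rewrite big1 // => n _; case: eqP => [e|]; rewrite ?mul0r //.
  by move: (ltn_ord n); rewrite -e ltnNge abN.
case: (posnP a) => [->|a0]; first by rewrite mul0n Z mul0r.
case: (posnP b) => [->|b0]; first by rewrite muln0 Z mulr0.
rewrite /F natrM powRM ?ler0n // mulrACA -exprMn.
rewrite ler_wpM2r ?mulr_ge0 ?powR_ge0 // lerXn2r ?nnegrE ?mulr_ge0 ?ler0n //.
by rewrite -natrM ler_nat size_divisors_mul.
Qed.

Lemma divisor_moment_bounded k : exists2 B : R, 0 < B & forall N, divisor_moment k N <= B.
Proof.
elim: k => [|k [B B0 HB]].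
  exists 3 => // N; have -> : (3 : R) = 1 + (1 / 2)^-1 by field.
  apply: le_trans (@sum_powR_le R (1 / 2) N _); last by lra.
  rewrite le_eqVlt; apply/orP; left; apply/eqP/eq_bigr => n _.
  by rewrite expr0 mul1r; congr (_ `^ _); lra.
exists (B ^+ 2); rewrite ?exprn_gt0 // => N.
apply: le_trans (divisor_momentS k N) _.
by rewrite lerXn2r ?nnegrE ?divisor_moment_ge0 // ltW.
Qed.

(** Bound the gcd by the sum of all common divisors [g] of [K] and [n]. For [n = g * j] the negative
    power absorbs the factor [g], leaving at most the corresponding power of [j]. *)
Lemma sum_gcdn_le (d : R) K N : (0 < K)%N -> 0 < d ->
  \sum_(n < N.+1) (gcdn K n)%:R * n%:R `^ (- (1 + d)) <=
    (size (divisors K))%:R * (1 + d^-1).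
Proof.
move=> K0 d0; set f := fun n : nat => n%:R `^ (- (1 + d)) : R.
have f0 n : 0 <= f n by apply: powR_ge0.
apply: le_trans (_ : \sum_(n < N.+1) \sum_(g <- divisors K) (g %| n)%N%:R * (g%:R * f n) <= _).
  apply: ler_sum => n _.
  rewrite (bigD1_seq (gcdn K n)) ?divisors_uniq //=; last first.
    by rewrite -dvdn_divisors ?dvdn_gcdl.
  rewrite dvdn_gcdr mul1r lerDl; apply: sumr_ge0 => g _.
  by rewrite !mulr_ge0 ?ler0n.
rewrite exchange_big /= -sum1_size natr_sum big_distrl /= big_seq [leRHS]big_seq.
apply: ler_sum => g gK; rewrite mul1r.
have g0 : (0 < g)%N by rewrite -dvdn_divisors // in gK; apply: dvdn_gt0 gK.
under eq_bigr do rewrite mulr_natl mulrb.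
rewrite -big_mkcond /= (sum_multiples (fun n => g%:R * f n)) //.
apply: le_trans (sum_powR_le (N %/ g) d0); apply: ler_sum => j _.
rewrite /f natrM powRM ?ler0n // mulrA ler_piMl // opprD.
have gp : 0 < g%:R :> R by rewrite ltr0n.
rewrite powRD ?(gt_eqF gp) ?implybT // powR_inv1 ?ler0n // mulrA divff ?gt_eqF // mul1r.
rewrite -[leRHS](powRr0 g%:R) ler_powR ?ler1n // oppr_le0; exact: ltW.
Qed.

End DivisorSums.

(** * Lcms of families, and sums weighted by them *)

Section BigLcm.
Variables (I : finType).
Implicit Types (P : pred I) (m : I -> nat).

Lemma dvdn_biglcmn P m i : P i -> (m i %| \big[lcmn/1%N]_(j | P j) m j)%N.
Proof. by move=> Pi; rewrite (bigD1 i) //= dvdn_lcml. Qed.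

Lemma biglcmn_dvdP P m k :
  (\big[lcmn/1%N]_(j | P j) m j %| k)%N <-> (forall j, P j -> (m j %| k)%N).
Proof.
split=> [lk j Pj|H]; first by apply: dvdn_trans (dvdn_biglcmn m Pj) lk.
by elim/big_rec: _ => [|j x Pj xk]; rewrite ?dvd1n // dvdn_lcm H.
Qed.

Lemma biglcmn_gt0 (r : seq I) P m : (forall i, P i -> 0 < m i)%N ->
  (0 < \big[lcmn/1%N]_(j <- r | P j) m j)%N.
Proof.
by move=> m0; elim/big_rec: _ => [|j x Pj x0] //; rewrite lcmn_gt0 m0.
Qed.

Lemma biglcmn_le_prod P m :
  (\big[lcmn/1%N]_(j | P j) m j <= \prod_(j | P j) m j)%N.
Proof.
elim/big_ind2: _ => // a b c d ab cd.
by apply: leq_trans (leq_div _ _) (leq_mul ab cd).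
Qed.

Lemma biglcmn_le_exp P m N : (forall i, m i <= N)%N ->
  (\big[lcmn/1%N]_(j | P j) m j <= N.+1 ^ #|I|)%N.
Proof.
move=> mN; apply: leq_trans (biglcmn_le_prod P m) _.
rewrite big_mkcond -[X in (_ <= X)%N]prod_nat_const /=; apply: leq_prod => i _.
by case: ifP => _ //; rewrite ltnW // ltnS.
Qed.

Variable R : realType.

(* The lcm [L] of the coordinates outside [J] is one of the integers up to
   [N.+1 ^ #|I|] divisible by all of them; once the sum runs over all such
   [L], it factors over the coordinates. *)
Lemma lcm_gcd_sum_bounded : exists2 B : R, 0 < B & forall (J : pred I) (d : R) N, 0 < d ->
  \sum_(m : {ffun I -> 'I_N.+1})
    (\big[lcmn/1%N]_(j | ~~ J j) m j)%:R `^ (- (3 / 2)) *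
    \prod_(i | J i) ((gcdn (\big[lcmn/1%N]_(j | ~~ J j) m j) (m i))%:R
                     * (m i)%:R `^ (- (1 + d)))
  <= B * (1 + d^-1) ^+ #|J|.
Proof.
have [B B0 HB] := divisor_moment_bounded R #|I|; exists B => // J d N d0.
have d1 : 0 <= 1 + d^-1 by rewrite addr_ge0 ?invr_ge0 ?ltW.
pose g (L : nat) (i : I) (n : nat) : R :=
  if J i then (gcdn L n)%:R * n%:R `^ (- (1 + d)) else (n %| L)%N%:R.
have g0 L i n : 0 <= g L i n.
  by rewrite /g; case: ifP => _; rewrite ?mulr_ge0 ?powR_ge0 ?ler0n.
pose N' := (N.+1 ^ #|I|)%N.
apply: le_trans (_ : \sum_(m : {ffun I -> 'I_N.+1}) \sum_(L < N'.+1)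
    L%:R `^ (- (3 / 2)) * \prod_i g L i (m i) <= _).
  apply: ler_sum => m _; set L := \big[_/_]_(_ | _) _.
  have LN : (L < N'.+1)%N.
    by rewrite ltnS; apply: biglcmn_le_exp => i; rewrite -ltnS.
  rewrite (bigD1 (Ordinal LN)) //= -[leLHS]addr0; apply: lerD; last first.
    by apply: sumr_ge0 => L' _; rewrite mulr_ge0 ?powR_ge0 ?prodr_ge0.
  rewrite ler_wpM2l ?powR_ge0 // big_mkcond le_eqVlt; apply/orP; left; apply/eqP.
  apply: eq_bigr => i _; rewrite /g; case: ifPn => // Ji.
  by rewrite (@dvdn_biglcmn (fun j => ~~ J j) (fun i => m i)).
rewrite exchange_big /=.
(* Off [J] the sum over a label counts divisors of [L]; on [J] it is bounded by [sum_gcdn_le]. Each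
   coordinate costs one divisor count, so a divisor moment remains. *)
apply: le_trans (_ : \sum_(L < N'.+1) ((size (divisors L))%:R ^+ #|I|
    * L%:R `^ (- (3 / 2))) * (1 + d^-1) ^+ #|J| <= _); last first.
  by rewrite -big_distrl /=; apply: ler_wpM2r; [exact: exprn_ge0|exact: HB].
apply: ler_sum => L _; rewrite -big_distrr /=.
case: (posnP L) => [->|L0].
  by rewrite powR0 ?mul0r ?mulr0 ?mul0r // oppr_eq0; apply/eqP; lra.
rewrite [X in _ <= X * _]mulrC -mulrA ler_wpM2l ?powR_ge0 //.
rewrite -(bigA_distr_bigA (fun i (n : 'I_N.+1) => g L i n)) /=.
apply: le_trans (_ : \prod_(i : I) ((size (divisors L))%:R * (if J i then 1 + d^-1 else 1)) <= _).
  apply: ler_prod => i _; rewrite sumr_ge0 //=; rewrite /g; case: ifP => _.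
    exact: sum_gcdn_le.
  by rewrite mulr1 -natr_sum ler_nat sum_dvdn_le.
rewrite big_split /= prodr_const -big_mkcond /= prodr_const; exact: lexx.
Qed.

End BigLcm.

(** [gcdn K n] divides [gcdn L n]. Thus one gcd with a global lcm [L] can serve at every vertex. *)
Lemma lcmn_gcdn_ge K L n : (0 < L)%N -> (K %| L)%N -> (K * n <= lcmn K n * gcdn L n)%N.
Proof.
move=> L0 KL; rewrite -muln_lcm_gcd leq_mul2l; apply/orP; right.
by apply: dvdn_leq; rewrite ?gcdn_gt0 ?L0 // dvdn_gcd dvdn_gcdr (dvdn_trans (dvdn_gcdl _ _) KL).
Qed.

(** * Lcms of the edge labels around the vertices *)

Section GraphLcm.
Variables (v : nat) (E : {set 'I_v * 'I_v}) (edgeE : is_edge_set E).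
Local Notation I := 'I_#|E|.
Implicit Types (m : I -> nat) (i j : I) (r s : 'I_v).

Local Notation inc r i := (incident r (enum_val i)).

Lemma edge_neq i : (enum_val i).1 != (enum_val i).2.
Proof.
have := enum_valP i; case: (enum_val i) => a b /edgeE /= ab.
by apply: contraTneq ab => ->; rewrite ltnn.
Qed.

(** The orientation of the pairs rules out listing an edge in both directions. *)
Lemma incident_edge_inj r s i j : r != s ->
  inc r i -> inc s i -> inc r j -> inc s j -> i = j.
Proof.
move=> rs ri si rj sj; apply: enum_val_inj; move: ri si rj sj.
have := enum_valP i; have := enum_valP j.
case: (enum_val i) => a b; case: (enum_val j) => c d /edgeE /= cd /edgeE /= ab.
rewrite /incident /=.
case/orP=> /eqP ?; case/orP=> /eqP ?; case/orP=> /eqP ?; case/orP=> /eqP ?; subst;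
  by rewrite ?eqxx // in rs *; move: ab; rewrite ltnNge ltnW.
Qed.

(* Adding an edge with label [n] to a subgraph multiplies the left side by
   [(n / gcd (L, n)) ^ 2] and the right side by at least as much. *)
Lemma biglcmn_sqr_le (P : pred I) m (t : seq I) : (forall i, 0 < m i)%N ->
  ((\big[lcmn/1]_(i <- t | P i) m i) ^ 2 <=
   \prod_(s < v) \big[lcmn/1]_(i <- t | P i && inc s i) m i)%N.
Proof.
move=> m0; elim: t => [|i t IH].
  by rewrite big_nil big1 // => s _; rewrite big_nil.
rewrite big_cons.
under [X in (_ <= X)%N]eq_bigr do rewrite big_cons.
case Pi: (P i) => //=; set L := \big[lcmn/1%N]_(_ <- t | _) _ in IH *.
pose K s := (\big[lcmn/1]_(i <- t | P i && inc s i) m i)%N.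
have L0 : (0 < L)%N by apply: biglcmn_gt0.
have K0 s : (0 < K s)%N by apply: biglcmn_gt0.
have KL s : (K s %| L)%N.
  rewrite /K /L; elim: (t) => [|k u IHu]; first by rewrite big_nil dvd1n.
  rewrite !big_cons; case: (P k) => //=; case: ifP => _.
    by rewrite dvdn_lcm dvdn_lcml (dvdn_trans IHu) ?dvdn_lcmr.
  by rewrite (dvdn_trans IHu) ?dvdn_lcmr.
set a := (enum_val i).1; set b := (enum_val i).2.
have ab : b != a by rewrite eq_sym edge_neq.
have ia : inc a i by rewrite /incident eqxx.
have ib : inc b i by rewrite /incident eqxx orbT.
(* Only the factors at the endpoints [a] and [b] of the new edge change. *)
rewrite (bigD1 a) //= (bigD1 b) //= ia ib.
move: IH; rewrite (bigD1 a) //= (bigD1 b) //= -/(K a) -/(K b).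
rewrite [X in (_ <= _ * (_ * X))%N -> _](eq_bigr K) //.
rewrite [X in _ -> (_ <= _ * (_ * X))%N](eq_bigr K) /=; last first.
  move=> s /andP[sa sb]; case: ifP => //; rewrite /incident.
  by rewrite eq_sym (negbTE sa) eq_sym (negbTE sb).
set Q := (\prod_(_ < v | _) _)%N => IH.
set n := m i; have n0 : (0 < n)%N := m0 i.
have g0 : (0 < gcdn L n)%N by rewrite gcdn_gt0 L0.
(* Multiplying by the square of [gcdn L n] turns the left side into [n ^ 2 * L ^ 2]. *)
rewrite -(leq_pmul2r g0) -(leq_pmul2r g0).
have := lcmn_gcdn_ge n L0 (KL a); have := lcmn_gcdn_ge n L0 (KL b).
have := muln_lcm_gcd L n; rewrite ![lcmn n _]lcmnC.
move: (K a) (K b) (gcdn L n) (lcmn L n) (lcmn (K a) n) (lcmn (K b) n) IH.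
move=> ka kb g l la lb IH e Hb Ha.
have -> : (l ^ 2 * g * g = n ^ 2 * L ^ 2)%N by rewrite -!mulnn; nia.
have -> : (la * (lb * Q) * g * g = (la * g) * (lb * g) * Q)%N by ring.
apply: leq_trans (leq_mul (leq_mul Ha Hb) (leqnn Q)).
have -> : (ka * n * (kb * n) * Q = n ^ 2 * (ka * (kb * Q)))%N by ring.
by rewrite leq_mul2l IH orbT.
Qed.

Lemma edge_lcm_gt0 m r : (forall i, 0 < m i)%N -> (0 < edge_lcm m r)%N.
Proof. by move=> m0; apply: biglcmn_gt0. Qed.

Lemma edge_lcm_sqr_le m : (forall i, 0 < m i)%N ->
  ((\big[lcmn/1]_i m i) ^ 2 <= \prod_(s < v) edge_lcm m s)%N.
Proof. by move=> m0; apply: (biglcmn_sqr_le xpredT). Qed.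

Lemma edge_lcm_le m r : (forall i, 0 < m i)%N ->
  (edge_lcm m r <= \big[lcmn/1]_i m i)%N.
Proof.
move=> m0; apply: dvdn_leq; first exact: biglcmn_gt0.
by apply/biglcmn_dvdP => j _; apply: (@dvdn_biglcmn _ xpredT).
Qed.

(* Each neighbour [s] of [r] has exactly one edge to [r]. *)
Lemma prod_edge_lcm_ge m r L : (forall i, 0 < m i)%N ->
  L = \big[lcmn/1%N]_(j | ~~ inc r j) m j ->
  (L ^ 2 * \prod_(i | inc r i) m i <=
   \prod_(s < v | s != r) edge_lcm m s * \prod_(i | inc r i) gcdn L (m i))%N.
Proof.
move=> m0 defL; have L0 : (0 < L)%N by rewrite defL; apply: biglcmn_gt0.
pose K s := (\big[lcmn/1]_(i | ~~ inc r i && inc s i) m i)%N.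
have KL s : (K s %| L)%N.
  by apply/biglcmn_dvdP => j /andP[rj _]; rewrite defL; apply: (@dvdn_biglcmn _ (fun j => ~~ inc r j)).
(* The edges counted in [L] avoid [r], so the factor at [r] is an empty lcm. *)
have LK : (L ^ 2 <= \prod_(s < v | s != r) K s)%N.
  rewrite defL; apply: leq_trans (biglcmn_sqr_le (fun i => ~~ inc r i) _ m0) _.
  rewrite (bigD1 r) //= big_pred0 ?mul1n // => i; exact: andNb.
(* An edge at [r] has exactly one other endpoint, which indexes the regrouping. *)
have split_inc (f : I -> nat) :
    (\prod_(i | inc r i) f i = \prod_(s < v | s != r) \prod_(i | inc r i && inc s i) f i)%N.
  under [RHS]eq_bigr do rewrite big_mkcondr.
  rewrite exchange_big /=; apply: eq_bigr => i ri.
  rewrite -big_mkcondr /=.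
  have [w ws] : exists w, (fun s => (s != r) && inc s i) =1 pred1 w.
    move: ri (edge_neq i); rewrite /incident; case: (enum_val i) => a b /=.
    case/orP => /eqP <- ab.
      exists b => s /=; have [->|sb] := eqVneq s b; first by rewrite eq_sym ab ?eqxx ?orbT.
      by rewrite orbF eq_sym andNb.
    exists a => s /=; have [->|sa] := eqVneq s a; first by rewrite ab ?eqxx.
    by rewrite /= eq_sym andNb.
  by rewrite (eq_bigl _ _ ws) big_pred1_eq.
rewrite !split_inc -big_split /=.
apply: leq_trans (leq_mul LK (leqnn _)) _; rewrite -big_split /=.
apply: leq_prod => s sr; rewrite /edge_lcm [X in (_ <= X * _)%N](bigID (fun i => inc r i)) /=.
have -> : (\big[lcmn/1]_(i | inc s i && ~~ inc r i) m i = K s)%N.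
  by apply: eq_bigl => i; rewrite andbC.
(* If an edge joins [r] and [s], its label enlarges [K s] as in [lcmn_gcdn_ge]; otherwise the inner
   products are empty. *)
case: (pickP (fun i => inc r i && inc s i)) => [i /andP[ri si]|no]; last first.
  by rewrite !(eq_bigl _ _ no) !big_pred0_eq !muln1 big_pred0 ?lcm1n // => i; rewrite andbC no.
have e : (fun j => inc r j && inc s j) =1 pred1 i.
  move=> j /=; apply/andP/eqP => [[rj sj]|->//].
  by apply: (@incident_edge_inj s r) => //.
rewrite !(eq_bigl _ _ e) !big_pred1_eq.
rewrite (eq_bigl (pred1 i)) ?big_pred1_eq; last by move=> j; rewrite andbC e.
by rewrite lcmnC lcmn_gcdn_ge.
Qed.

End GraphLcm.

(** * Moebius expansion of the coprime sum *)

Section WeightedSum.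
Variables (R : realType) (v : nat) (E : {set 'I_v * 'I_v}).
Local Notation I := 'I_#|E|.
Implicit Types (m : I -> nat) (i j : I) (r s : 'I_v).

(** [rho_term] for labels given by a plain function, so that it also applies to labels in
    ['I_N.+1]. *)
Definition weight m : R :=
  (\prod_i moebius (m i))%:~R / (\prod_(r < v) edge_lcm m r)%N%:R.

(** [moebius 0] is 0, so sums over ['I_N.+1] may include the label 0. *)
Lemma weight_eq0 m i : m i = 0%N -> weight m = 0.
Proof. by move=> mi0; rewrite /weight (bigD1 i) //= mi0 mul0r mul0r. Qed.

Lemma normr_moebius_le1 n : `|moebius n| <= 1.
Proof. by rewrite /moebius; case: ifP => _; rewrite ?normr0 // normrX normrN normr1 expr1n. Qed.

Lemma normr_weight_le m : `|weight m| <= (\prod_(r < v) (edge_lcm m r)%:R)^-1.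
Proof.
rewrite /weight normrM normfV natr_prod [X in _ / X]ger0_norm ?prodr_ge0 //.
rewrite ler_piMl ?invr_ge0 ?prodr_ge0 // -intr_norm normr_prod.
rewrite -[leRHS]/(1%:~R) ler_int; apply: prodr_ile1 => i _.
by rewrite normr_ge0 normr_moebius_le1.
Qed.

Lemma sum_moebius_gcdn a b N : (0 < a <= N)%N -> (0 < b)%N ->
  \sum_(d < N.+1) (moebius d)%:~R * ((d %| a) && (d %| b))%N%:R = (coprime a b)%:R :> R.
Proof.
case/andP=> a0 aN b0; have g0 : (0 < gcdn a b)%N by rewrite gcdn_gt0 a0.
transitivity ((coprime a b)%:R%:~R : R); last by rewrite rmorph_nat.
rewrite /coprime -sum_moebius_divisors // (perm_big _ (@perm_divisors _ N _)); last first.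
  by rewrite g0 (leq_trans _ aN) // dvdn_leq // dvdn_gcdl.
rewrite big_filter big_mkord [X in X%:~R]big_mkcond rmorph_sum; apply: eq_bigr => d _.
by rewrite dvdn_gcd; case: ifP => _; rewrite ?mulr1 ?mulr0.
Qed.

Lemma edge_lcm_dvdP m (a : 'I_v -> nat) :
  [forall r, edge_lcm m r %| a r]%N =
  [forall i, (m i %| a (enum_val i).1) && (m i %| a (enum_val i).2)]%N.
Proof.
apply/forallP/forallP => [H i|H r].
  by rewrite !(dvdn_trans _ (H _)) //; apply: (@dvdn_biglcmn _ (fun j => incident _ (enum_val j)));
    rewrite /incident eqxx ?orbT.
apply/biglcmn_dvdP => i; rewrite /incident.
by case/andP: (H i) => h1 h2 /orP[] /eqP <-.
Qed.

Lemma prodr_nat_bool (K : finType) (b : pred K) : \prod_k (b k)%:R = [forall k, b k]%:R :> R.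
Proof.
case: (boolP [forall k, b k]) => [/forallP H|].
  by rewrite big1 // => k _; rewrite H.
by rewrite negb_forall => /existsP[k /negbTE bk]; rewrite (bigD1 k) //= bk mul0r.
Qed.

Lemma sum_invr_multiples M n : (0 < M)%N ->
  \sum_(k < n.+1) (M %| k)%N%:R * k%:R^-1 = M%:R^-1 * harmonic_sum R (n %/ M) :> R.
Proof.
move=> M0; under eq_bigr do rewrite mulr_natl mulrb.
rewrite -big_mkcond /= (sum_multiples (fun k => k%:R^-1)) //.
rewrite big_ord_recl /= muln0 invr0 add0r /harmonic_sum big_add1 big_mkord big_distrr.
by apply: eq_bigr => j _; rewrite natrM invfM.
Qed.

(** Expand the indicator of each edge by [sum_moebius_gcdn], distribute the product into a sum over
    labelings, and regroup the divisibilities by vertex. *)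
Lemma Gcoprime_indicator (a : 'I_v -> nat) N : (forall r, 0 < a r <= N)%N ->
  (Gcoprime E a)%:R = \sum_(m : {ffun I -> 'I_N.+1})
    (\prod_i moebius (m i))%:~R * \prod_(r < v) (edge_lcm (fun i => m i) r %| a r)%N%:R :> R.
Proof.
move=> aN.
have -> : (Gcoprime E a)%:R = \prod_(i < #|E|) (coprime (a (enum_val i).1) (a (enum_val i).2))%:R :> R.
  rewrite prodr_nat_bool; congr (nat_of_bool _)%:R; apply/forall_inP/forallP.
    by move=> H i; apply/H/enum_valP.
  by move=> H p pE; rewrite -(enum_rankK_in pE pE).
under eq_bigr => i _.
  have /andP[h0 _] := aN (enum_val i).2.
  rewrite -(@sum_moebius_gcdn _ _ N) //; over.
rewrite (bigA_distr_bigA (fun i (d : 'I_N.+1) => (moebius d)%:~R * ((d %| a (enum_val i).1) && (d %| a (enum_val i).2))%N%:R : R)) /=.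
apply: eq_bigr => m _; rewrite big_split /= rmorph_prod; congr (_ * _).
rewrite [RHS](prodr_nat_bool (fun r => edge_lcm _ r %| a r)%N).
by rewrite (edge_lcm_dvdP (fun i => m i)) -prodr_nat_bool.
Qed.

(** [N] is kept free so that the range of the labels can later tend to infinity while [x] stays
    fixed. *)
Lemma Gcoprime_sumE (x : R) N : (Num.truncn x <= N)%N ->
  Gcoprime_sum E x = \sum_(m : {ffun I -> 'I_N.+1})
    weight (fun i => m i) *
    \prod_(r < v) harmonic_sum R (Num.truncn x %/ edge_lcm (fun i => m i) r).
Proof.
rewrite /Gcoprime_sum; set n := Num.truncn x => nN.
transitivity (\sum_(a : {ffun 'I_v -> 'I_n.+1}) \sum_(m : {ffun I -> 'I_N.+1})
    (\prod_i moebius (m i))%:~R *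
    \prod_(r < v) ((edge_lcm (fun i => m i) r %| a r)%N%:R * (a r)%:R^-1) : R).
  rewrite big_mkcond; apply: eq_bigr => a _.
  under [RHS]eq_bigr do rewrite big_split /= mulrA.
  rewrite -big_distrl /=; case: (boolP [forall i, (0 < a i)%N]) => /= [/forallP a0|]; last first.
    rewrite negb_forall => /existsP[i]; rewrite -eqn0Ngt => /eqP ai0.
    by rewrite [X in _ * X](bigD1 i) //= ai0 invr0 mul0r mulr0.
  rewrite -(@Gcoprime_indicator (fun r => a r) N); last first.
    by move=> r; rewrite a0 /= (leq_trans _ nN) // -ltnS.
  by rewrite prodfV; case: ifP => _; rewrite ?mul1r ?mul0r.
rewrite exchange_big /=; apply: eq_bigr => m _.
case: (pickP (fun i => (m i : nat) == 0%N)) => [i /eqP mi0|m0].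
  rewrite (@weight_eq0 _ i) // mul0r big1 // => a _.
  by rewrite (bigD1 i) //= mi0 mul0r mul0r.
rewrite -big_distrr /= -(bigA_distr_bigA (fun r (k : 'I_n.+1) =>
   (edge_lcm (fun i => m i) r %| k)%N%:R * k%:R^-1 : R)) /=.
rewrite /weight -mulrA natr_prod; congr (_ * _); rewrite -prodfV -big_split /=.
apply: eq_bigr => r _; rewrite sum_invr_multiples //.
by apply: edge_lcm_gt0 => i; rewrite lt0n m0.
Qed.

End WeightedSum.

(** * Replacing harmonic sums by logarithms *)

Section ProductApproximation.
Variable R : realType.

Lemma prod_sub_le (n : nat) (h l : 'I_n -> R) (A : R) : 0 <= A ->
  (forall r, `|h r| <= A) -> (forall r, `|l r| <= A) ->
  `|\prod_r h r - \prod_r l r| <= A ^+ n.-1 * \sum_r `|h r - l r|.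
Proof.
move=> A0; elim: n h l => [|n IH] h l hA lA.
  by rewrite !big_ord0 subrr normr0 mulr0.
rewrite !big_ord_recl /=; set Ph := \prod_(i < n) _; set Pl := \prod_(i < n) _.
have -> : h ord0 * Ph - l ord0 * Pl = (h ord0 - l ord0) * Ph + l ord0 * (Ph - Pl).
  by ring.
apply: le_trans (ler_normD _ _) _; rewrite [leRHS]mulrDr; apply: lerD.
  rewrite normrM mulrC ler_wpM2r // /Ph normr_prod.
  apply: le_trans (_ : \prod_(i < n) A <= _); last by rewrite prodr_const card_ord.
  by apply: ler_prod => i _; rewrite normr_ge0 hA.
rewrite normrM; apply: le_trans (ler_pM _ _ (lA ord0) (IH _ _ _ _)) _ => //.
(* For [n = 0] the truncated exponent [n.-1] is off by one, but [S] is empty. *)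
set S := \sum_(_ < n) _; have [n0|n0] := posnP n; last by rewrite mulrA -exprS prednK.
suff -> : S = 0 by rewrite !mulr0.
by apply: big1 => i; have := ltn_ord i; rewrite {2}n0.
Qed.

Variable g : R.
Hypothesis g01 : 0 <= g <= 1.
Hypothesis gP : forall n, (0 < n)%N ->
  harmonic_sum R n - ln n.+1%:R <= g <= harmonic_sum R n - ln n%:R.

Lemma ln_ge1_gt1 (x : R) : 1 <= ln x -> 1 < x.
Proof. by move=> x1; rewrite ltNge; apply/negP => /ln_le0; lra. Qed.

Lemma truncn_div_bounds (x : R) M : 0 <= x -> (0 < M)%N ->
  (Num.truncn x %/ M)%:R <= x / M%:R < (Num.truncn x %/ M).+1%:R.
Proof.
move=> x0 M0; have /andP[nx xn] := truncn_itv x0; set n := Num.truncn x in nx xn *.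
have M0' : 0 < M%:R :> R by rewrite ltr0n.
rewrite ler_pdivlMr // ltr_pdivrMr // -!natrM; apply/andP; split.
  by apply: le_trans nx; rewrite ler_nat leq_trunc_div.
by apply: lt_le_trans xn _; rewrite ler_nat ltn_ceil.
Qed.

(** With [k] the integer part of [x / M%:R], both [harmonic_sum k - g] and [ln x - ln M%:R] lie
    between [ln k] and [ln (k + 1)], at distance at most [1 / k]; and
    [x / M%:R < k + 1 <= 2 * k]. *)
Lemma harmonic_sum_approx (x : R) M : 1 <= ln x -> (0 < M)%N -> M%:R <= x ->
  [/\ 0 <= ln x - ln M%:R,
      `|harmonic_sum R (Num.truncn x %/ M)| <= 2 * ln x &
      `|harmonic_sum R (Num.truncn x %/ M) - (ln x + g - ln M%:R)| <= 2 * (M%:R / x)].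
Proof.
move=> T1 M0 Mx; have x1 := ln_ge1_gt1 T1; have x0 : 0 < x by lra.
have M0' : 0 < M%:R :> R by rewrite ltr0n.
have /andP[kx xk] := truncn_div_bounds (ltW x0) M0.
set k := (_ %/ _)%N in kx xk *.
have k0 : (0 < k)%N.
  rewrite lt0n; apply/eqP => k0; move: xk; rewrite k0 ltr_pdivrMr // mul1r; lra.
have k0' : 0 < k%:R :> R by rewrite ltr0n.
have e : ln (x / M%:R) = ln x - ln M%:R by rewrite ln_div ?posrE.
have xM0 : 0 < x / M%:R by rewrite divr_gt0.
have l1 : ln k%:R <= ln x - ln M%:R by rewrite -e ler_ln ?posrE.
have l2 : ln x - ln M%:R <= ln k.+1%:R by rewrite -e ler_ln ?posrE ?ltr0n // ltW.
have k1 : 0 <= ln k%:R :> R by rewrite ln_ge0 // ler1n.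
have M1 : 0 <= ln M%:R :> R by rewrite ln_ge0 // ler1n.
have /andP[g1 g2] := gP k0.
have hk := harmonic_le_ln R k0; have h0 := harmonic_sum_ge0 R k.
have s := ln_succ_le_invr R k0.
have kM : k%:R^-1 <= 2 * (M%:R / x).
  rewrite -[M%:R / x]invf_div ler_pdivlMr // mulrC ler_pdivrMr //.
  apply: le_trans (ltW xk) _.
  by rewrite -natrM ler_nat mul2n -addnn -addn1 leq_add2l.
split; first by lra.
  by rewrite ger0_norm //; move: h0 hk l1 M1 T1; move: (harmonic_sum _ _) (ln k%:R) (ln M%:R) => a b c; lra.
rewrite ler_norml; move: g1 g2 l1 l2 s kM.
move: (harmonic_sum _ _) (ln k%:R) (ln k.+1%:R) (ln M%:R) (k%:R^-1) (2 * _) => a b b' c q z.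
by move=> *; apply/andP; split; lra.
Qed.

(* A family with all [M r <= x] is handled factor by factor.  When the largest
   [M r = x exp u] exceeds [x], the product of harmonic sums vanishes,
   the factor [ln x + g - ln (M r)] is [O(1 + u)], and the others are
   [O(ln x * (1 + u))], with [(1 + u) ^ v = O(exp (u / 2))]. *)
Lemma harmonic_prod_approx (v d : nat) : exists2 C : R, 0 < C &
  forall (x : R) (M : 'I_v -> nat), 1 <= ln x -> 2 * d%:R <= ln x ->
  (forall r, 0 < M r)%N ->
  `|\prod_r harmonic_sum R (Num.truncn x %/ M r) - \prod_r (ln x + g - ln (M r)%:R)|
   <= C * x^-1 * ln x ^+ v.-1 * \sum_r (M r)%:R `^ (1 - d%:R / ln x).
Proof.
have [D D0 HD] := @expr_le_expR R v.
(* The 2 serves the families with all [M r <= x] and [D] the others; [expR d%:R] is [x] to the power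
   [d%:R / ln x], undoing Rankin's factor. *)
exists ((2 + D) * 2 ^+ v.-1 * expR d%:R).
  by rewrite !mulr_gt0 ?expR_gt0 ?exprn_gt0 ?addr_gt0.
move=> x M T1 Td M0; have x1 := ln_ge1_gt1 T1; have x0 : 0 < x by lra.
have /andP[g0 g1] := g01.
set T := ln x in T1 Td *; have T0 : 0 < T by lra.
have c0 : 0 <= 2 ^+ v.-1 * T ^+ v.-1 by rewrite mulr_ge0 // exprn_ge0 // ltW.
have M0' r : 0 < (M r)%:R :> R by rewrite ltr0n.
have lM r : 0 <= ln (M r)%:R :> R by rewrite ln_ge0 // ler1n.
have xT : x^-1 = expR (- T) by rewrite expRN lnK ?posrE.
have Mpow r : (M r)%:R `^ (1 - d%:R / T) = expR ((1 - d%:R / T) * ln (M r)%:R) :> R.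
  by rewrite /powR gt_eqF.
have [/forallP Mx|] := boolP [forall r, (M r)%:R <= x].
  apply: le_trans (@prod_sub_le v _ _ (2 * T) _ _ _) _.
  - by lra.
  - by move=> r; case: (harmonic_sum_approx T1 (M0 r) (Mx r)).
  - move=> r; case: (harmonic_sum_approx T1 (M0 r) (Mx r)) => h _ _.
    by move: (lM r) h; rewrite -/T ler_norml; move: (ln (M r)%:R) => c *; apply/andP; split; lra.
  rewrite exprMn !mulr_sumr; apply: ler_sum => r _.
  have [h _ h3] := harmonic_sum_approx T1 (M0 r) (Mx r).
  apply: le_trans (ler_wpM2l _ h3) _; first by rewrite mulr_ge0 ?exprn_ge0 ?ltW.
  have -> : (2 + D) * 2 ^+ v.-1 * expR d%:R * x^-1 * T ^+ v.-1 * (M r)%:R `^ (1 - d%:R / T) =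
     (2 ^+ v.-1 * T ^+ v.-1) * ((2 + D) * (expR d%:R * (M r)%:R `^ (1 - d%:R / T) / x)) by ring.
  rewrite ler_wpM2l //; apply: ler_pM => //; [by rewrite divr_ge0 // ltW|by lra|].
  rewrite ler_pM2r ?invr_gt0 // Mpow -expRD -{1}[(M r)%:R]lnK ?posrE // ler_expR.
  have : d%:R / T * ln (M r)%:R <= d%:R / T * T.
    by rewrite ler_wpM2l ?divr_ge0 ?(ltW T0) // -subr_ge0.
  rewrite divfK ?gt_eqF //; move: (ln _%:R) (d%:R / T) => a b; lra.
rewrite negb_forall => /existsP[r0]; rewrite -ltNge => Mr0.
have [r _ rmax] := @arg_maxnP _ r0 xpredT M isT.
have Mle s : (M s <= M r)%N := rmax s isT.
have Mr : x < (M r)%:R by apply: lt_le_trans Mr0 _; rewrite ler_nat Mle.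
rewrite [X in `|X - _|](bigD1 r) //= divn_small; last first.
  have /andP[nx _] := truncn_itv (ltW x0).
  by rewrite -(ltr_nat R); apply: le_lt_trans nx Mr.
rewrite harmonic_sum0 mul0r sub0r normrN normr_prod.
set u := ln (M r)%:R - T; have u0 : 0 <= u by rewrite subr_ge0 ler_ln ?posrE // ltW.
have b1 : `|T + g - ln (M r)%:R| <= 1 + u.
  by rewrite ler_norml /u; move: u0; rewrite /u; move: (ln _%:R) => c *; apply/andP; split; lra.
have b2 s : `|T + g - ln (M s)%:R| <= (2 * T) * (1 + u).
  have : ln (M s)%:R <= u + T.
    by rewrite subrK ler_ln ?posrE // ler_nat Mle.
  have : 0 <= T * u by rewrite mulr_ge0 // ltW.
  have : 0 <= (T - 1) * u by rewrite mulr_ge0 // subr_ge0.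
  move: (lM s); rewrite ler_norml; move: (ln _%:R) => c *; apply/andP; split; nra.
have v0 : (0 < v)%N by apply: leq_ltn_trans (ltn_ord r).
apply: le_trans (_ : (2 * T) ^+ v.-1 * (1 + u) ^+ v <= _).
  have -> : (1 + u) ^+ v = (1 + u) * (1 + u) ^+ v.-1 by rewrite -exprS prednK.
  rewrite (bigD1 r) //= mulrCA -exprMn.
  apply: ler_pM; rewrite ?prodr_ge0 //.
  apply: le_trans (_ : \prod_(s < v | s != r) (2 * T * (1 + u)) <= _).
    by apply: ler_prod => s _; rewrite normr_ge0 b2.
  by rewrite prodr_const cardC1 card_ord.
rewrite (bigD1 r) //= mulrDr -[leLHS]addr0; apply: lerD; last first.
  have D2 : 0 <= 2 + D by lra.
  rewrite !mulr_ge0 ?invr_ge0 ?exprn_ge0 ?expR_ge0 ?(ltW x0) ?(ltW T0) //.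
  by apply: sumr_ge0 => s _; rewrite powR_ge0.
rewrite exprMn.
have -> : (2 + D) * 2 ^+ v.-1 * expR d%:R * x^-1 * T ^+ v.-1 * (M r)%:R `^ (1 - d%:R / T) =
     (2 ^+ v.-1 * T ^+ v.-1) * ((2 + D) * (expR d%:R * x^-1 * (M r)%:R `^ (1 - d%:R / T))) by ring.
rewrite ler_wpM2l //; apply: le_trans (HD u u0) _.
apply: ler_pM; [exact: ltW|exact: expR_ge0|by lra|].
rewrite xT Mpow -!expRD ler_expR.
have -> : d%:R + - T + (1 - d%:R / T) * ln (M r)%:R = (1 - d%:R / T) * u.
  by rewrite /u; field; rewrite gt_eqF.
(* Since [2 * d%:R <= T], the coefficient of [u] is at least 1 / 2, enough to absorb
   [expR (u / 2)]. *)
rewrite mulrC ler_wpM2r // lerBrDl -lerBrDr ler_pdivrMr //; lra.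
Qed.

End ProductApproximation.

(** * Summability of the weights and the error term *)

Section WeightBounds.
Variables (R : realType) (v : nat) (E : {set 'I_v * 'I_v}) (edgeE : is_edge_set E).
Local Notation I := 'I_#|E|.
Local Notation inc r i := (incident r (enum_val i)).
Implicit Types (m : I -> nat) (i j : I) (r s : 'I_v).
Local Notation wt := (@weight R v E).

Lemma degree_card r : degree E r = #|[pred i : I | inc r i]|.
Proof.
rewrite /degree -sum1_card -[RHS]sum1_card [RHS]big_mkcond.
rewrite -(big_enum_val (idx := 0%N) (fun p => if incident r p then 1%N else 0%N)).
by rewrite -big_mkcondr /=; apply: eq_bigl => p; rewrite inE.
Qed.

(** By [edge_lcm_sqr_le] the weight is at most the inverse square of the lcm. The spare square root
    will absorb powers of logarithms in polynomial coefficients. *)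
Lemma normr_weight_sqrt_le m : (forall i, 0 < m i)%N ->
  `|wt m| * (\big[lcmn/1%N]_i m i)%:R `^ (1 / 2) <=
  (\big[lcmn/1%N]_i m i)%:R `^ (- (3 / 2)).
Proof.
move=> m0; set L := \big[lcmn/1%N]_i m i.
have L0 : 0 < L%:R :> R by rewrite ltr0n biglcmn_gt0.
have -> : - (3 / 2) = - (2%:R) + 1 / 2 :> R by lra.
rewrite powRD ?(gt_eqF L0) ?implybT // ler_wpM2r ?powR_ge0 //.
apply: le_trans (normr_weight_le R m) _.
rewrite powRN powR_mulrn ?(ltW L0) // -natrX -natr_prod lef_pV2 ?posrE ?ltr0n ?expn_gt0 ?ler_nat.
- exact: edge_lcm_sqr_le.
- by apply: prodn_gt0 => r; apply: edge_lcm_gt0.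
- by rewrite biglcmn_gt0.
Qed.

Lemma sum_normr_weight_sqrt_bounded : exists2 B : R, 0 < B & forall N,
  \sum_(m : {ffun I -> 'I_N.+1})
    `|wt (fun i => m i)| * (\big[lcmn/1%N]_i (m i : nat))%:R `^ (1 / 2) <= B.
Proof.
have [B B0 HB] := lcm_gcd_sum_bounded I R; exists B => // N.
(* With [J] empty, the value 1 of the exponent parameter is arbitrary. *)
have := HB pred0 1 N ltr01; rewrite card0 expr0 mulr1; apply: le_trans.
apply: ler_sum => m _; rewrite [X in _ <= _ * X]big_pred0 ?mulr1 //.
case: (pickP (fun i => (m i : nat) == 0%N)) => [i /eqP mi0|m0].
  by rewrite (weight_eq0 R (i := i)) // normr0 mul0r powR_ge0.
by apply: normr_weight_sqrt_le => i; rewrite lt0n m0.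
Qed.

(** The lcm at [r] cancels against its occurrence in the weight. Rankin's factor is shared among the
    at most [d] labels at [r], each at most that lcm, and [prod_edge_lcm_ge] handles the other
    vertices. *)
Lemma normr_weight_powR_le m r (d : nat) (T : R) L : (degree E r <= d)%N -> 0 < T ->
  (forall i, 0 < m i)%N -> L = \big[lcmn/1%N]_(j | ~~ inc r j) m j ->
  `|wt m| * (edge_lcm m r)%:R `^ (1 - d%:R / T) <=
  L%:R `^ (- (3 / 2)) *
    \prod_(i | inc r i) ((gcdn L (m i))%:R * (m i)%:R `^ (- (1 + T^-1))).
Proof.
move=> dd T0 m0 defL; have L0n : (0 < L)%N by rewrite defL biglcmn_gt0.
have L0 : 0 < L%:R :> R by rewrite ltr0n.
set M := edge_lcm m r; have M0 : (0 < M)%N by apply: edge_lcm_gt0.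
have M0' : 0 < M%:R :> R by rewrite ltr0n.
have m0' i : 0 < (m i)%:R :> R by rewrite ltr0n.
pose P := (\prod_(s < v | s != r) edge_lcm m s)%N.
have P0 : (0 < P)%N by apply: prodn_cond_gt0 => s _; apply: edge_lcm_gt0.
have key := prod_edge_lcm_ge edgeE m0 defL; rewrite -/P in key.
apply: le_trans (_ : P%:R^-1 * (M%:R `^ T^-1 ^+ d)^-1 <= _).
  apply: le_trans (ler_wpM2r (powR_ge0 _ _) (normr_weight_le R m)) _.
  rewrite (bigD1 r) //= -natr_prod -/P -/M invfM.
  rewrite powRD ?(gt_eqF M0') ?implybT // powRr1 ?(ltW M0') //.
  rewrite mulrACA mulVf ?(gt_eqF M0') // mul1r powRN [d%:R / T]mulrC powRrM.
  by rewrite powR_mulrn ?powR_ge0.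
have Mm : \prod_(i | inc r i) (m i)%:R `^ T^-1 <= M%:R `^ T^-1 ^+ d :> R.
  apply: le_trans (_ : \prod_(i | inc r i) M%:R `^ T^-1 <= _).
    apply: ler_prod => i ri; rewrite powR_ge0 ge0_ler_powR ?nnegrE ?invr_ge0 ?(ltW T0) ?ler0n //=.
    rewrite ler_nat dvdn_leq //; exact: (@dvdn_biglcmn _ (fun j => inc r j)).
  rewrite prodr_const -degree_card; apply: ler_weXn2l => //.
  by rewrite -[leLHS](powRr0 M%:R) ler_powR ?ler1n // invr_ge0 ltW.
under eq_bigr => i _.
  rewrite opprD powRD ?(gt_eqF (m0' i)) ?implybT // powR_inv1 ?ler0n // powRN mulrA; over.
rewrite big_split /= prodfV mulrA.
apply: ler_pM; rewrite ?invr_ge0 ?ler0n ?exprn_ge0 ?powR_ge0 //; last first.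
  by rewrite lef_pV2 // posrE ?exprn_gt0 ?powR_gt0 // prodr_gt0 // => i _; rewrite powR_gt0.
apply: le_trans (_ : L%:R ^- 2 * \prod_(i | inc r i) ((gcdn L (m i))%:R / (m i)%:R) <= _).
  rewrite big_split /= prodfV -!natr_prod.
  rewrite mulrA [_ ^- 2 * _]mulrC -mulrA -invfM ler_pdivlMr; last first.
    by rewrite mulr_gt0 ?exprn_gt0 // ltr0n prodn_cond_gt0.
  rewrite mulrC ler_pdivrMr ?ltr0n // -natrX -!natrM ler_nat.
  by rewrite [X in (_ <= X)%N]mulnC.
rewrite ler_wpM2r //; first by apply: prodr_ge0 => i _; rewrite divr_ge0 ?ler0n.
(* The exponent -2 is weakened to -3/2, to match [lcm_gcd_sum_bounded]. *)
rewrite -powR_mulrn ?(ltW L0) // -powRN ler_powR ?ler1n //; lra.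
Qed.

(** This is [lcm_gcd_sum_bounded] with [J] the edges at [r] and [d = T^-1], so each such edge costs
    a factor [1 + T]. *)
Lemma sum_normr_weight_powR_bounded : exists2 B : R, 0 < B &
  forall r (d : nat) (T : R) N, (degree E r <= d)%N -> 0 < T ->
  \sum_(m : {ffun I -> 'I_N.+1})
    `|wt (fun i => m i)| * (edge_lcm (fun i => m i) r)%:R `^ (1 - d%:R / T)
  <= B * (1 + T) ^+ degree E r.
Proof.
have [B B0 HB] := lcm_gcd_sum_bounded I R; exists B => // r d T N dd T0.
have Ti : 0 < T^-1 by rewrite invr_gt0.
have := HB (fun i => inc r i) T^-1 N Ti; rewrite invrK degree_card; apply: le_trans.
apply: ler_sum => m _.
case: (pickP (fun i => (m i : nat) == 0%N)) => [i /eqP mi0|m0].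
  rewrite (weight_eq0 R (i := i)) // normr0 mul0r mulr_ge0 ?powR_ge0 //.
  by apply: prodr_ge0 => j _; rewrite mulr_ge0 ?powR_ge0 ?ler0n.
by apply: normr_weight_powR_le => // i; rewrite lt0n m0.
Qed.

Variable g : R.
Hypothesis g01 : 0 <= g <= 1.
Hypothesis gP : forall n, (0 < n)%N ->
  harmonic_sum R n - ln n.+1%:R <= g <= harmonic_sum R n - ln n%:R.

Lemma Gcoprime_sum_approx : (0 < v)%N -> exists2 C : R, 0 < C & forall (x : R) N,
  1 <= ln x -> 2 * (max_degree E)%:R <= ln x -> (Num.truncn x <= N)%N ->
  `|Gcoprime_sum E x - \sum_(m : {ffun I -> 'I_N.+1}) wt (fun i => m i) *
      \prod_(r < v) (ln x + g - ln (edge_lcm (fun i => m i) r)%:R)|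
  <= C * (x^-1 * ln x ^+ (v + max_degree E - 1)).
Proof.
move=> v0; set d := max_degree E.
have [C C0 HC] := harmonic_prod_approx g01 gP v d.
have [B B0 HB] := sum_normr_weight_powR_bounded.
(* [v%:R] comes from summing over the vertices, [2 ^+ d] from [1 + T <= 2 * T]. *)
exists (C * (B * v%:R * 2 ^+ d)); first by rewrite !mulr_gt0 ?exprn_gt0 ?ltr0n.
move=> x N T1 Td xN; rewrite (Gcoprime_sumE _ xN).
have x0 : 0 < x by have := ln_ge1_gt1 T1; lra.
set T := ln x in T1 Td *; have T0 : 0 < T by lra.
rewrite -sumrB; apply: le_trans (ler_norm_sum _ _ _) _.
apply: le_trans (_ : \sum_(m : {ffun I -> 'I_N.+1}) C * x^-1 * T ^+ v.-1 *
    \sum_(r < v) `|wt (fun i => m i)| * (edge_lcm (fun i => m i) r)%:R `^ (1 - d%:R / T) <= _).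
  apply: ler_sum => m _; rewrite -mulrBr normrM.
  case: (pickP (fun i => (m i : nat) == 0%N)) => [i /eqP mi0|m0].
    rewrite (weight_eq0 R (i := i)) // normr0 mul0r big1 ?mulr0 // => r _; exact: mul0r.
  rewrite -mulr_sumr mulrCA ler_wpM2l //; apply: HC => // r.
  by apply: edge_lcm_gt0 => i; rewrite lt0n m0.
rewrite -mulr_sumr exchange_big /=.
apply: le_trans (_ : C * x^-1 * T ^+ v.-1 * (\sum_(r < v) B * (2 * T) ^+ d) <= _).
  rewrite ler_wpM2l ?mulr_ge0 ?exprn_ge0 ?invr_ge0 ?(ltW C0) ?(ltW T0) ?(ltW x0) //.
  apply: ler_sum => r _; have dr : (degree E r <= d)%N by apply: (leq_bigmax r).
  apply: le_trans (HB r d T N dr T0) _; rewrite ler_wpM2l ?(ltW B0) //.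
  apply: le_trans (_ : (2 * T) ^+ degree E r <= _); last by apply: ler_weXn2l => //; lra.
  by rewrite lerXn2r // ?nnegrE; lra.
rewrite sumr_const card_ord -mulr_natr exprMn.
have -> : (v + d - 1 = v.-1 + d)%N by case: (v) v0 => // w _; rewrite addSn subn1.
rewrite exprD le_eqVlt; apply/orP; left; apply/eqP; ring.
Qed.

End WeightBounds.

(** * Lower bound from integers in a residue class *)

Section LowerBound.
Variable R : realType.

Section Residue.
Variable Q : nat.
Hypothesis Q1 : (1 < Q)%N.

Definition residue_one_inv (k : nat) : R := (k %% Q == 1)%N%:R * k%:R^-1.

Definition residue_one_sum (n : nat) : R := \sum_(0 <= k < n.+1) residue_one_inv k.

Lemma residue_one_inv_ge0 k : 0 <= residue_one_inv k.
Proof. by rewrite mulr_ge0 ?invr_ge0 ?ler0n. Qed.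

Lemma residue_one_sum_mono m n : (m <= n)%N -> residue_one_sum m <= residue_one_sum n.
Proof.
move=> mn; rewrite /residue_one_sum [leRHS](@big_cat_nat _ _ _ m.+1) //= lerDl.
by apply: sumr_ge0 => k _; apply: residue_one_inv_ge0.
Qed.

(** Compare [Q * j + 1] with [Q * j.+1] term by term. *)
Lemma harmonic_sum_le_residue J :
  harmonic_sum R J.+1 / Q%:R <= residue_one_sum (Q * J + 1).
Proof.
have Q0 : (0 < Q)%N by apply: ltnW.
have Q0' : 0 < Q%:R :> R by rewrite ltr0n.
elim: J => [|J IH].
  rewrite harmonic_sumS harmonic_sum0 add0r invr1 mul1r muln0 add0n.
  rewrite /residue_one_sum big_nat_recr //= /residue_one_inv modn_small // eqxx mul1r invr1.
  rewrite ler_wpDl ?sumr_ge0 // ?invf_le1 ?ler1n // => k _; exact: residue_one_inv_ge0.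
rewrite harmonic_sumS mulrDl.
apply: le_trans (_ : residue_one_sum (Q * J.+1) + residue_one_inv (Q * J.+1 + 1) <= _); last first.
  by rewrite /residue_one_sum addn1 [leRHS]big_nat_recr.
apply: lerD.
  by apply: le_trans IH (residue_one_sum_mono _); rewrite mulnS addnC leq_add2r ltnW.
rewrite /residue_one_inv mulnC modnMDl modn_small // eqxx mul1r -invfM -natrM.
by rewrite lef_pV2 ?posrE ?ltr0n ?muln_gt0 ?addn1 ?Q0 // ler_nat; nia.
Qed.

(** The choice of [J] gives [x < Q * (J + 2)], so [ln (J + 2) >= ln x - ln Q], which is at least
    half of [ln x]. *)
Lemma residue_one_sum_ge (x : R) : 1 <= x -> 2 * ln Q%:R <= ln x ->
  ln x / (2 * Q%:R) <= residue_one_sum (Num.truncn x).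
Proof.
move=> x1 xQ; have x0 : 0 < x by lra.
have Q0 : (0 < Q)%N by apply: ltnW.
have Q0' : 0 < Q%:R :> R by rewrite ltr0n.
have /andP[nx xn] := truncn_itv (ltW x0); set n := Num.truncn x in nx xn *.
have n0 : (0 < n)%N by rewrite -ltnS -(ltr_nat R) (le_lt_trans x1).
set J := (n.-1 %/ Q)%N.
apply: le_trans (_ : harmonic_sum R J.+1 / Q%:R <= _); last first.
  apply: le_trans (harmonic_sum_le_residue J) (residue_one_sum_mono _).
  by have := leq_trunc_div n.-1 Q; rewrite -/J mulnC; lia.
rewrite invfM mulrA ler_pM2r ?invr_gt0 //.
apply: le_trans (ln_le_harmonic_sum R J.+1).
have : ln x <= ln (Q%:R * J.+2%:R).
  rewrite ler_ln ?posrE ?mulr_gt0 ?ltr0n // (le_trans (ltW xn)) // -natrM ler_nat.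
  have := ltn_ceil n.-1 Q0; rewrite -/J => h.
  rewrite mulnC mulSn addnC; apply: leq_trans (_ : n + 1 <= _)%N; first by rewrite addn1.
  by apply: leq_add => //; rewrite -{1}(prednK n0).
rewrite lnM ?posrE ?ltr0n //; move: xQ; move: (ln Q%:R) (ln J.+2%:R) => a b; lra.
Qed.

(* With [c] the least inverse of [g] modulo [Q], the shift [j |-> j - c + 1]
   maps the residue class of the inverses of [g] below that of [1]. *)
Lemma sum_residue_multiples g n : (0 < g)%N ->
  \sum_(k < n.+1) (g %| k)%N%:R * residue_one_inv k <= residue_one_sum n / g%:R.
Proof.
move=> g0; under eq_bigr do rewrite mulr_natl mulrb.
rewrite -big_mkcond /= (sum_multiples residue_one_inv) //.
have -> : \sum_(j < (n %/ g).+1) residue_one_inv (g * j) =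
    (\sum_(0 <= j < (n %/ g).+1) ((g * j) %% Q == 1)%N%:R * j%:R^-1) / g%:R.
  rewrite big_mkord big_distrl /=; apply: eq_bigr => j _.
  by rewrite /residue_one_inv natrM invfM mulrCA mulrC -mulrA.
rewrite ler_wpM2r ?invr_ge0 ?ler0n //; set A := (n %/ g)%N.
have An : (A <= n)%N by apply: leq_div.
have s0 : 0 <= residue_one_sum n by apply: sumr_ge0 => k _; apply: residue_one_inv_ge0.
case: (boolP (has (fun j => (g * j) %% Q == 1)%N (index_iota 0 A.+1))) => [hj|/hasPn nj]; last first.
  rewrite big1_seq // => j /andP[_ jA]; by rewrite (negbTE (nj j jA)) mul0r.
have ex : exists j, ((g * j) %% Q == 1)%N by case/hasP: hj => j _ jj; exists j.
case: (ex_minnP ex) => c cc cmin.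
have cA : (c <= A)%N.
  by case/hasP: hj => j; rewrite mem_index_iota ltnS => jA /cmin cj; apply: leq_trans cj jA.
have c0 : (0 < c)%N by case: c cc {cmin cA} => //; rewrite muln0 mod0n.
rewrite (@big_cat_nat _ _ _ c) //=; last by rewrite leqW.
rewrite big_nat_cond big1 ?add0r; last first.
  move=> j /andP[/andP[_ jc] _]; case: eqP => [/eqP /cmin|_]; last by rewrite mul0r.
  by rewrite leqNgt jc.
rewrite -{1}[c]add0n big_addn /residue_one_sum.
have cop : coprime Q g.
  rewrite coprime_sym; apply/eqP/eqP; rewrite -dvdn1.
  have : (gcdn g Q %| g * c)%N by rewrite dvdn_mulr ?dvdn_gcdl.
  by rewrite (divn_eq (g * c) Q) (eqP cc) dvdn_addr // dvdn_mull ?dvdn_gcdr.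
apply: le_trans (_ : \sum_(0 <= i < A.+1 - c) residue_one_inv i.+1 <= _).
  apply: ler_sum => i _; rewrite /residue_one_inv.
  case: eqP => [gi|_]; last by rewrite mul0r mulr_ge0 ?invr_ge0 ?ler0n.
  (* [g * (i + c)] and [g * c] are both 1 modulo [Q], and [g] is coprime to [Q]. *)
  have Qi : (Q %| i)%N.
    rewrite -(Gauss_dvdr _ cop); have : (g * (i + c) == g * c %[mod Q])%N by rewrite gi (eqP cc).
    by rewrite eqn_mod_dvd ?leq_mul2l ?leq_addl ?orbT // -mulnBr addnK.
  have -> : (i.+1 %% Q)%N = 1%N by rewrite -addn1 -modnDml (eqP Qi) modn_small.
  by rewrite !eqxx !mul1r lef_pV2 ?posrE ?ltr0n ?addn_gt0 ?c0 ?orbT // ler_nat -addn1 leq_add2l.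
rewrite [leRHS]big_nat_recl // -[leLHS]add0r lerD ?residue_one_inv_ge0 //.
rewrite [leRHS](@big_cat_nat _ _ _ (A.+1 - c)) //=; last by rewrite leq_subLR -addn1 addnC leq_add.
by rewrite lerDl sumr_ge0 // => k _; apply: residue_one_inv_ge0.
Qed.

End Residue.

Lemma sum_inv_sqr_le y n : (0 < y)%N -> \sum_(y.+1 <= k < n.+1) k%:R ^- 2 <= y%:R^-1 :> R.
Proof.
move=> y0; have y0' : 0 < y%:R :> R by rewrite ltr0n.
case: (leqP n y) => [ny|yn]; first by rewrite big_geq ?invr_ge0 ?ltW.
suff: \sum_(y.+1 <= k < n.+1) k%:R ^- 2 <= y%:R^-1 - n%:R^-1 :> R.
  by move/le_trans; apply; rewrite gerBl invr_ge0 ler0n.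
elim: n {yn} (ltnW yn) => [|n IH]; first by case: y y0 {y0'}.
rewrite leq_eqVlt => /predU1P[<-|]; first by rewrite big_geq // subrr.
rewrite ltnS => yn; rewrite big_nat_recr //=.
apply: le_trans (lerD (IH yn) (_ : _ <= n%:R^-1 - n.+1%:R^-1)) _; last by rewrite addrA subrK.
have n0 : 0 < n%:R :> R by rewrite ltr0n (leq_trans y0).
have -> : n%:R^-1 - n.+1%:R^-1 = (n%:R * n.+1%:R)^-1 :> R.
  by rewrite -natr1; field; rewrite natr1 !gt_eqF // ltr0n.
rewrite expr2 !invfM ler_wpM2r ?invr_ge0 ?ler0n //.
by rewrite lef_pV2 ?posrE ?ltr0n ?(leq_trans y0 yn) // ler_nat.
Qed.

End LowerBound.

Section GcoprimeLowerBound.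
Variables (R : realType) (v : nat) (E : {set 'I_v * 'I_v}) (edgeE : is_edge_set E).

(** The sum factors over the coordinates; by [sum_residue_multiples] those at [p] and [q] each gain
    a factor [g%:R^-1]. *)
Lemma sum_pair_multiples Q n g (p q : 'I_v) : (1 < Q)%N -> (0 < g)%N -> p != q ->
  \sum_(a : {ffun 'I_v -> 'I_n.+1}) (\prod_r residue_one_inv R Q (a r)) *
     ((g %| a p)%N%:R * (g %| a q)%N%:R)
  <= residue_one_sum R Q n ^+ v * g%:R ^- 2.
Proof.
move=> Q1 g0 pq; set f := residue_one_inv R Q; set h := residue_one_sum R Q n.
pose F r (k : 'I_n.+1) : R := (if (r == p) || (r == q) then (g %| k)%N%:R else 1) * f k.
have f0 k : 0 <= f k by apply: residue_one_inv_ge0.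
have h0 : 0 <= h by apply: sumr_ge0 => k _; apply: f0.
have split2 (G : 'I_v -> R) : \prod_r (if (r == p) || (r == q) then G r else 1) = G p * G q.
  rewrite (bigD1 p) //= eqxx (bigD1 q) 1?eq_sym //= eqxx orbT big1 ?mulr1 //.
  by move=> r /andP[/negbTE -> /negbTE ->].
have -> : \sum_(a : {ffun 'I_v -> 'I_n.+1}) (\prod_r f (a r)) *
    ((g %| a p)%N%:R * (g %| a q)%N%:R) = \sum_(a : {ffun 'I_v -> 'I_n.+1}) \prod_r F r (a r).
  apply: eq_bigr => a _; rewrite /F [RHS]big_split /= [LHS]mulrC.
  by rewrite (split2 (fun r => (g %| a r)%N%:R)).
rewrite -(bigA_distr_bigA F) /=.
have -> : h ^+ v * g%:R ^- 2 = \prod_(r < v) ((if (r == p) || (r == q) then g%:R^-1 else 1) * h).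
  by rewrite big_split /= (split2 (fun=> g%:R^-1)) prodr_const card_ord mulrC -expr2 exprVn.
apply: ler_prod => r _; rewrite sumr_ge0 /=; last first.
  by move=> k _; rewrite /F mulr_ge0 //; case: ifP.
rewrite /F; case: ifP => _; first by rewrite mulrC; apply: sum_residue_multiples.
by under eq_bigr do rewrite mul1r; rewrite mul1r /h /residue_one_sum big_mkord.
Qed.

(* Integers congruent to [1] modulo [y!] have no common divisor in [2 .. y];
   a union bound over the possible common divisors exceeding [y] then shows
   that at least half of the tuples of such integers (weighted by the inverse
   of their product) are coprime along all the edges. *)
Lemma Gcoprime_sum_ge_residue (x : R) : 1 <= x ->
  residue_one_sum R (8 * #|E| + 2)`! (Num.truncn x) ^+ v / 2 <= Gcoprime_sum E x.
Proof.
move=> x1; set y := (8 * #|E| + 2)%N; set Q := y`!.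
have y0 : (0 < y)%N by rewrite /y addn2.
have Q1 : (1 < Q)%N by apply: leq_trans (fact_geq y); rewrite /y addn2.
rewrite /Gcoprime_sum; set n := Num.truncn x.
set f := residue_one_inv R Q; set h := residue_one_sum R Q n.
have f0 k : 0 <= f k by apply: residue_one_inv_ge0.
have h0 : 0 <= h by apply: sumr_ge0 => k _; apply: f0.
(* For tuples in the residue class, [1 - bad a] is at most the coprimality indicator: a failing edge
   has a common divisor above [y], which makes [bad a] at least 1. *)
pose bad (a : {ffun 'I_v -> 'I_n.+1}) : R :=
  \sum_(p in E) \sum_(y.+1 <= g < n.+1) (g %| a p.1)%N%:R * (g %| a p.2)%N%:R.
have bad0 a : 0 <= bad a by apply: sumr_ge0 => p _; apply: sumr_ge0 => g _; rewrite mulr_ge0.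
apply: le_trans (_ : \sum_(a : {ffun 'I_v -> 'I_n.+1}) (\prod_r f (a r)) * (1 - bad a) <= _); last first.
  rewrite [leRHS]big_mkcond; apply: ler_sum => a _.
  set rhs := (if _ then _ else _); have rhs0 : 0 <= rhs.
    by rewrite /rhs; case: ifP => // _; rewrite invr_ge0 prodr_ge0.
  case: (boolP [forall r, (a r %% Q == 1)%N]) => [/forallP aQ|]; last first.
    rewrite negb_forall => /existsP[r /negbTE ar].
    by rewrite (bigD1 r) //= /f /residue_one_inv ar !mul0r.
  have a0 r : (0 < a r)%N by move: (aQ r); case: (a r : nat) => //; rewrite mod0n.
  have fa : \prod_r f (a r) = (\prod_r (a r)%:R)^-1.
    by rewrite -prodfV; apply: eq_bigr => r _; rewrite /f /residue_one_inv aQ mul1r.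
  case: (boolP (Gcoprime E (fun r => a r))) => [cop|].
    rewrite /rhs cop andbT ifT; last by apply/forallP.
    by rewrite fa ler_piMr ?invr_ge0 ?prodr_ge0 // gerBl.
  rewrite negb_forall_in => /exists_inP[p pE ncop]; apply: le_trans rhs0.
  rewrite mulr_ge0_le0 ?prodr_ge0 // subr_le0 /bad (bigD1 p) //=.
  rewrite -[leLHS]addr0; apply: lerD; last first.
    by apply: sumr_ge0 => q _; apply: sumr_ge0 => g _; rewrite mulr_ge0.
  set G := gcdn (a p.1) (a p.2).
  have G0 : (0 < G)%N by rewrite gcdn_gt0 a0.
  have Gn : (G < n.+1)%N by apply: leq_ltn_trans (dvdn_leq (a0 p.1) (dvdn_gcdl _ _)) (ltn_ord _).
  have yG : (y < G)%N.
    rewrite ltnNge; apply/negP => Gy; case/negP: ncop; rewrite /coprime -/G -dvdn1.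
    have : (G %| a p.1)%N by apply: dvdn_gcdl.
    rewrite (divn_eq (a p.1) Q) (eqP (aQ p.1)) dvdn_addr // dvdn_mull //.
    by rewrite dvdn_fact // G0.
  rewrite (bigD1_seq G) ?iota_uniq ?mem_index_iota ?yG //= dvdn_gcdl dvdn_gcdr mulr1.
  by rewrite lerDl sumr_ge0 // => g _; rewrite mulr_ge0.
under eq_bigr do rewrite mulrBr mulr1.
rewrite sumrB.
have -> : \sum_(a : {ffun 'I_v -> 'I_n.+1}) \prod_r f (a r) = h ^+ v.
  rewrite -(bigA_distr_bigA (fun (r : 'I_v) (k : 'I_n.+1) => f k)) /= prodr_const card_ord.
  by rewrite /h /residue_one_sum big_mkord.
have -> : \sum_(a : {ffun 'I_v -> 'I_n.+1}) (\prod_r f (a r)) * bad a =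
    \sum_(p in E) \sum_(y.+1 <= g < n.+1) \sum_(a : {ffun 'I_v -> 'I_n.+1})
      (\prod_r f (a r)) * ((g %| a p.1)%N%:R * (g %| a p.2)%N%:R).
  under eq_bigr do rewrite /bad big_distrr /=.
  rewrite exchange_big /=; apply: eq_bigr => p _.
  under eq_bigr do rewrite big_distrr /=.
  by rewrite exchange_big.
have hv : 0 <= h ^+ v by rewrite exprn_ge0.
rewrite lerBrDr -lerBrDl.
apply: le_trans (_ : \sum_(p in E) h ^+ v * y%:R^-1 <= _).
  apply: ler_sum => p pE.
  apply: le_trans (_ : \sum_(y.+1 <= g < n.+1) h ^+ v * g%:R ^- 2 <= _).
    rewrite big_nat_cond [leRHS]big_nat_cond; apply: ler_sum => g /andP[/andP[yg _] _].
    apply: sum_pair_multiples => //; first exact: leq_trans yg.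
    case: p pE => i j /edgeE /= ij; by apply: contraTneq ij => ->; rewrite ltnn.
  by rewrite -mulr_sumr ler_wpM2l // sum_inv_sqr_le.
(* The choice of [y] makes [#|E|%:R / y%:R] at most 1 / 2. *)
rewrite sumr_const -[leLHS]mulr_natr -[leLHS]mulrA.
have -> : h ^+ v - h ^+ v / 2 = h ^+ v * (1 / 2) by field.
rewrite ler_wpM2l // mulrC ler_pdivrMr ?ltr0n //.
by rewrite /y natrD natrM; have := ler0n R #|E|; move: (#|E|%:R) => e; lra.
Qed.

Lemma Gcoprime_sum_ge : exists2 c : R, 0 < c & exists T0 : R, forall x : R,
  T0 <= ln x -> c * ln x ^+ v <= Gcoprime_sum E x.
Proof.
set Q := (8 * #|E| + 2)`!.
have Q1 : (1 < Q)%N by apply: leq_trans (fact_geq _); rewrite addn2.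
have Q0 : 0 < Q%:R :> R by rewrite ltr0n ltnW.
exists ((2 * Q%:R)^-1 ^+ v / 2); first by rewrite divr_gt0 // exprn_gt0 // invr_gt0 mulr_gt0.
(* The extra 1 forces [ln x > 0], hence [1 <= x]. *)
exists (2 * ln Q%:R + 1) => x xQ.
have lQ : 0 <= ln Q%:R :> R by rewrite ln_ge0 // ler1n ltnW.
have x1 : 1 <= x by rewrite leNgt; apply/negP => /ltW /ln_le0; lra.
apply: le_trans (Gcoprime_sum_ge_residue x1).
rewrite mulrAC ler_pM2r ?invr_gt0 // -exprMn lerXn2r ?nnegrE //.
- by rewrite mulr_ge0 ?invr_ge0 ?mulr_ge0 ?(ltW Q0) //; lra.
- by apply: sumr_ge0 => k _; apply: residue_one_inv_ge0.
by rewrite mulrC; apply: residue_one_sum_ge => //; lra.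
Qed.

End GcoprimeLowerBound.

(** * Unordered sums as limits over cubes *)

Section CubeSums.
Variables (R : realType) (I : finType).
Implicit Types f : {ffun I -> nat} -> R.

Definition cube_point N (m : {ffun I -> 'I_N.+1}) : {ffun I -> nat} :=
  [ffun i => m i : nat].

Definition cube_sum f N : R := \sum_(m : {ffun I -> 'I_N.+1}) f (cube_point m).

Lemma cube_point_inj N : injective (@cube_point N).
Proof.
move=> m n /ffunP mn; apply/ffunP => i; apply: val_inj.
by have := mn i; rewrite !ffunE.
Qed.

Lemma sum_seq_le_cube_sum f N (s : seq {ffun I -> nat}) : (forall m, 0 <= f m) ->
  uniq s -> (forall m, m \in s -> forall i, m i <= N)%N -> \sum_(m <- s) f m <= cube_sum f N.
Proof.
move=> f0 us sN; pose h (m : {ffun I -> nat}) : {ffun I -> 'I_N.+1} := [ffun i => inord (m i)].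
have hK m : m \in s -> cube_point (h m) = m.
  by move=> ms; apply/ffunP => i; rewrite !ffunE inordK // ltnS sN.
have -> : \sum_(m <- s) f m = \sum_(c <- map h s) f (cube_point c).
  by rewrite big_map; apply: eq_big_seq => m ms; rewrite hK.
rewrite big_uniq /=; last first.
  by rewrite map_inj_in_uniq // => m n ms ns e; rewrite -(hK m ms) -(hK n ns) e.
by rewrite big_mkcond; apply: ler_sum => c _; case: ifP.
Qed.

Lemma cube_sum_mono f : (forall m, 0 <= f m) ->
  {homo cube_sum f : N N' / (N <= N')%N >-> N <= N'}.
Proof.
move=> f0 N N' NN'; rewrite {1}/cube_sum -(big_map (@cube_point N) xpredT f).
apply: sum_seq_le_cube_sum => //.
  by rewrite map_inj_uniq ?index_enum_uniq //; apply: cube_point_inj.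
by move=> _ /mapP[c _ ->] i; rewrite ffunE (leq_trans _ NN') // -ltnS.
Qed.

Local Open Scope classical_set_scope.

(** Every finite set of labelings lies in a cube, and the part of a cube inside [S] is finite and
    carries its whole sum; so both values are the supremum of the cube sums. *)
Lemma esum_cube_sum f B (S : set {ffun I -> nat}) : (forall m, 0 <= f m) ->
  (forall m, ~ S m -> f m = 0) -> (forall N, cube_sum f N <= B) ->
  exists2 l : R, \esum_(m in S) (f m)%:E = l%:E & cube_sum f @ \oo --> l.
Proof.
move=> f0 fS fB; have ub : has_ubound (range (cube_sum f)).
  by exists B => _ [N _ <-].
have cl := nondecreasing_cvgn (cube_sum_mono f0) ub.
exists (sup (range (cube_sum f))) => //; apply/eqP; rewrite eq_le; apply/andP; split.
  apply: ge_ereal_sup => _ [X [finX XS] <-]; rewrite fsbig_finite // sumEFin lee_fin.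
  set s := finmap.enum_fset _.
  (* A crude bound for every coordinate of every point of [s]. *)
  pose N := (\sum_(m <- s) \sum_i m i)%N.
  apply: le_trans (_ : cube_sum f N <= _); last by apply: ub_le_sup => //; exists N.
  apply: sum_seq_le_cube_sum => //; first exact: finmap.fset_uniq.
  move=> m ms i; rewrite /N (big_rem m ms) /= (bigD1 i) //= -addnA; exact: leq_addr.
have supE (y : \bar R) : (forall N, ((cube_sum f N)%:E <= y)%E) -> ((sup (range (cube_sum f)))%:E <= y)%E.
  case: y => [r||] H; rewrite ?leey //.
    by rewrite lee_fin; apply: ge_sup; [exists (cube_sum f 0%N); exists 0%N|move=> _ [N _ <-]; rewrite -lee_fin].
  by have := H 0%N.
apply: supE => N.
pose s := [seq cube_point c | c <- enum {: {ffun I -> 'I_N.+1}} & `[< S (cube_point c) >]].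
have us : uniq s by rewrite (map_inj_uniq (@cube_point_inj N)); apply/filter_uniq/enum_uniq.
apply: esum_ge; exists [set` s].
  split; first exact: finite_seq.
  by move=> m /= /mapP[c]; rewrite mem_filter => /andP[/asboolP Sc _] ->.
rewrite -fsbig_seq // sumEFin lee_fin /s big_map big_filter big_enum_cond /cube_sum.
rewrite (bigID (fun c => `[< S (cube_point c) >])) /= [X in _ + X]big1 ?addr0.
  by rewrite le_eqVlt; apply/orP; left; apply/eqP; apply: eq_bigl => c.
by move=> c /asboolPn /fS.
Qed.

(** Apply [esum_cube_sum] to the positive and negative parts, both dominated by the absolute value.
    The limit has the form in which [rho] is defined. *)
Lemma cube_sum_cvg f B (S : set {ffun I -> nat}) :
  (forall m, ~ S m -> f m = 0) -> (forall N, cube_sum (fun m => `|f m|) N <= B) ->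
  let F m := (f m)%:E in
  cube_sum f @ \oo --> fine (\esum_(m in S) (F^\+ m) - \esum_(m in S) (F^\- m))%E.
Proof.
move=> fS fB F; pose fp m := Num.max (f m) 0; pose fn m := Num.max (- f m) 0.
have le_abs (h : {ffun I -> nat} -> R) N : (forall m, h m <= `|f m|) -> cube_sum h N <= B.
  by move=> H; apply: le_trans (fB N); apply: ler_sum => m _; apply: H.
have [|||lp Elp clp] := @esum_cube_sum fp B S.
- by move=> m; rewrite /fp le_max lexx orbT.
- by move=> m /fS fm; rewrite /fp fm maxxx.
- by move=> N; apply: le_abs => m; rewrite /fp ge_max ler_norm normr_ge0.
have [|||ln Eln cln] := @esum_cube_sum fn B S.
- by move=> m; rewrite /fn le_max lexx orbT.
- by move=> m /fS fm; rewrite /fn fm oppr0 maxxx.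
- by move=> N; apply: le_abs => m; rewrite /fn ge_max -normrN ler_norm normr_ge0.
have -> : \esum_(m in S) (F^\+ m)%E = lp%:E.
  by rewrite -Elp; apply: eq_esum => m _; rewrite funeposE /F /fp EFin_max.
have -> : \esum_(m in S) (F^\- m)%E = ln%:E.
  by rewrite -Eln; apply: eq_esum => m _; rewrite funenegE /F /fn EFin_max.
have -> : cube_sum f = (fun N => cube_sum fp N - cube_sum fn N).
  apply/funext => N; rewrite /cube_sum -sumrB; apply: eq_bigr => m _; rewrite /fp /fn.
  move: (f _) => y; case: (leP 0 y) => h.
    by rewrite max_r ?subr0 // oppr_le0.
  by rewrite max_l ?sub0r ?opprK // oppr_ge0 ltW.
exact: cvgB.
Qed.

Lemma cvg_sum_ord n (u : nat -> nat -> R) (l : nat -> R) :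
  (forall j, u j @ \oo --> l j) ->
  (fun N => \sum_(j < n) u j N) @ \oo --> \sum_(j < n) l j.
Proof.
move=> ul; elim: n => [|n IH].
  rewrite big_ord0; under eq_fun do rewrite big_ord0; exact: cvg_cst.
rewrite big_ord_recr; under eq_fun do rewrite big_ord_recr /=.
by apply: cvgD => //; apply: ul.
Qed.

End CubeSums.

(** * Coefficients of the limit polynomial *)

Section RootProducts.
Variable R : realType.

Lemma normr_coef_prod_XsubC_le n (c : 'I_n -> R) j :
  `|(\prod_(r < n) ('X - (c r)%:P))`_j| <= \prod_(r < n) (1 + `|c r|).
Proof.
elim: n c j => [|n IH] c j.
  by rewrite !big_ord0 coef1; case: (j == 0%N); rewrite ?normr1 ?normr0.
rewrite !big_ord_recl /= mulrBl coefB coefXM coefCM.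
set p := \prod_(i < n) _; set q := \prod_(i < n) _.
have pq k : `|p`_k| <= q by apply: IH.
have q0 : 0 <= q by apply: le_trans (pq 0%N).
apply: le_trans (ler_normB _ _) _; rewrite mulrDl mul1r normrM; apply: lerD.
  by case: ifP => _; rewrite ?normr0.
by rewrite ler_wpM2l.
Qed.

End RootProducts.

Section LimitPolynomial.
Variables (R : realType) (v : nat) (E : {set 'I_v * 'I_v}) (edgeE : is_edge_set E).
Local Notation I := 'I_#|E|.
Variable g : R.
Hypothesis g01 : 0 <= g <= 1.

(** The variable stands for [ln x]; explicit roots give the size and monicity directly. *)
Definition root_poly (m : I -> nat) : {poly R} :=
  \prod_(r < v) ('X - (ln (edge_lcm m r)%:R - g)%:P).

Lemma horner_root_poly m t : (root_poly m).[t] = \prod_(r < v) (t + g - ln (edge_lcm m r)%:R).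
Proof.
rewrite horner_prod; apply: eq_bigr => r _; rewrite hornerXsubC; ring.
Qed.

Lemma size_root_poly m : size (root_poly m) = v.+1.
Proof. by rewrite /root_poly size_prod_XsubC /index_enum -enumT size_enum_ord. Qed.

Lemma coef_root_poly m : (root_poly m)`_v = 1.
Proof.
have := monic_prod_XsubC (index_enum 'I_v) xpredT (fun r => ln (edge_lcm m r)%:R - g).
by rewrite monicE /lead_coef -/(root_poly m) size_root_poly /= => /eqP.
Qed.

(** With [L] the lcm of all labels, the roots are at most [1 + ln L] in absolute value, and
    [(1 + ln L) ^+ v] is bounded through [expr_le_expR] at [u = ln L]. *)
Lemma normr_coef_root_poly_le : exists2 C : R, 0 < C & forall m j, (forall i, 0 < m i)%N ->
  `|(root_poly m)`_j| <= C * (\big[lcmn/1%N]_i m i)%:R `^ (1 / 2).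
Proof.
have [D D0 HD] := @expr_le_expR R v; exists (2 ^+ v * D); first by rewrite mulr_gt0 // exprn_gt0.
move=> m j m0; apply: le_trans (normr_coef_prod_XsubC_le _ _) _.
set L := \big[lcmn/1%N]_i m i; have L0 : (0 < L)%N by apply: biglcmn_gt0.
have L0' : 0 < L%:R :> R by rewrite ltr0n.
have l0 : 0 <= ln L%:R :> R by rewrite ln_ge0 // ler1n.
apply: le_trans (_ : \prod_(r < v) (2 * (1 + ln L%:R)) <= _).
  apply: ler_prod => r _; rewrite addr_ge0 //=.
  have M0 : (0 < edge_lcm m r)%N by apply: edge_lcm_gt0.
  have : ln (edge_lcm m r)%:R <= ln L%:R :> R.
    by rewrite ler_ln ?posrE ?ltr0n // ler_nat edge_lcm_le.
  have : 0 <= ln (edge_lcm m r)%:R :> R by rewrite ln_ge0 // ler1n.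
  have /andP[g0 g1] := g01; move: l0; move: (ln L%:R) (ln (edge_lcm m r)%:R) => a b a0 b0 ab.
  rewrite -lerBrDl ler_norml; apply/andP; split; lra.
rewrite prodr_const card_ord exprMn -mulrA ler_pM2l ?exprn_gt0 //.
apply: le_trans (HD _ l0) _; rewrite ler_pM2l //.
by rewrite /powR gt_eqF // mulrC -mulrA mul1r mulrC lexx.
Qed.

Local Notation wt := (@weight R v E).

Definition coef_term j (m : {ffun I -> nat}) : R := wt m * (root_poly m)`_j.

Lemma cube_pointE N (m : {ffun I -> 'I_N.+1}) :
  (cube_point m : I -> nat) = (fun i => m i : nat).
Proof. by apply/funext => i; rewrite ffunE. Qed.

Lemma cube_sum_coef_term_bounded : exists B : R, forall j N,
  cube_sum (fun m => `|coef_term j m|) N <= B.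
Proof.
have [C C0 HC] := normr_coef_root_poly_le.
have [B B0 HB] := sum_normr_weight_sqrt_bounded R edgeE.
exists (C * B) => j N; apply: le_trans (ler_wpM2l (ltW C0) (HB N)).
rewrite mulr_sumr; apply: ler_sum => m _; rewrite /coef_term cube_pointE normrM mulrCA.
case: (pickP (fun i => (m i : nat) == 0%N)) => [i /eqP mi0|m0].
  by rewrite (weight_eq0 R (i := i)) // normr0 !mul0r.
by rewrite ler_wpM2l //; apply: HC => i; rewrite lt0n m0.
Qed.

Lemma coef_term_eq0 j m : ~ pos_tuples E m -> coef_term j m = 0.
Proof.
move=> /existsNP[i /negP]; rewrite -eqn0Ngt => /eqP mi0.
by rewrite /coef_term (weight_eq0 R mi0) mul0r.
Qed.

Lemma rho_term_coef_term : @rho_term v R E = coef_term v.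
Proof. by apply/funext => m; rewrite /coef_term coef_root_poly mulr1. Qed.

Local Open Scope classical_set_scope.

Lemma weighted_poly_cvg : exists2 q : nat -> R, q v = rho R E &
  forall t, (fun N => \sum_(m : {ffun I -> 'I_N.+1}) wt (fun i => m i) *
      \prod_(r < v) (t + g - ln (edge_lcm (fun i => m i) r)%:R)) @ \oo
    --> (\poly_(j < v.+1) q j).[t].
Proof.
have [B HB] := cube_sum_coef_term_bounded.
(* This copies the form of [rho]; since [root_poly] is monic, [coef_term v] is [rho_term] and [q v]
   is [rho R E]. *)
pose q j := fine (\esum_(m in pos_tuples E) ((fun m => (coef_term j m)%:E)^\+ m) -
                  \esum_(m in pos_tuples E) ((fun m => (coef_term j m)%:E)^\- m))%E.
exists q; first by rewrite /q -rho_term_coef_term.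
move=> t; rewrite horner_poly.
have -> : (fun N => \sum_(m : {ffun I -> 'I_N.+1}) wt (fun i => m i) *
      \prod_(r < v) (t + g - ln (edge_lcm (fun i => m i) r)%:R)) =
    (fun N => \sum_(j < v.+1) cube_sum (coef_term j) N * t ^+ j).
  apply/funext => N.
  under [RHS]eq_bigr do rewrite /cube_sum mulr_suml.
  rewrite exchange_big /=; apply: eq_bigr => m _.
  rewrite -horner_root_poly (@horner_coef_wide _ v.+1) ?size_root_poly // mulr_sumr.
  by apply: eq_bigr => j _; rewrite /coef_term cube_pointE mulrA.
apply: (@cvg_sum_ord R v.+1 (fun j N => cube_sum (coef_term j) N * t ^+ j) (fun j => q j * t ^+ j)).
move=> j; apply: cvgMl; apply: (@cube_sum_cvg _ _ _ B) => [m|N]; first exact: coef_term_eq0.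
exact: HB.
Qed.

End LimitPolynomial.

(** * The limit in the label range, positivity of [rho], and the asymptotic formula *)

Section Assembly.
Variables (R : realType) (v : nat) (E : {set 'I_v * 'I_v}) (edgeE : is_edge_set E).
Local Open Scope classical_set_scope.

(** The bound of [Gcoprime_sum_approx] is uniform in [N], so it survives letting [N] tend to
    infinity at fixed [x]. *)
Lemma Gcoprime_sum_poly : (0 < v)%N -> exists2 q : nat -> R, q v = rho R E &
  exists2 C : R, 0 < C & forall x : R, 1 <= ln x -> 2 * (max_degree E)%:R <= ln x ->
  `|Gcoprime_sum E x - (\poly_(j < v.+1) q j).[ln x]| <=
    C * (x^-1 * ln x ^+ (v + max_degree E - 1)).
Proof.
move=> v0; have [g g01 gP] := euler_constant_exists R.
have [q qv qP] := weighted_poly_cvg edgeE g01; exists q => //.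
have [C C0 HC] := Gcoprime_sum_approx edgeE g01 gP v0; exists C => // x x1 x2.
apply: (cvgr_to_le (cvg_norm (cvgB (cvg_cst (Gcoprime_sum E x)) (qP (ln x))))).
near=> N; apply: HC => //; near: N; exact: nbhs_infty_ge.
Unshelve. all: by end_near.
Qed.

Lemma poly_le_expr (q : nat -> R) n t : 1 <= t -> (0 < n)%N -> q n <= 0 ->
  (\poly_(j < n.+1) q j).[t] <= (\sum_(j < n) `|q j|) * t ^+ n.-1.
Proof.
move=> t1 n0 qn; rewrite horner_poly big_ord_recr /= -[leRHS]addr0; apply: lerD; last first.
  by rewrite mulr_le0_ge0 // exprn_ge0 //; lra.
rewrite mulr_suml; apply: ler_sum => j _; apply: le_trans (ler_norm _) _.
rewrite normrM ler_wpM2l // ger0_norm; last by rewrite exprn_ge0 //; lra.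
by apply: ler_weXn2l => //; rewrite -ltnS prednK.
Qed.

(* Otherwise the polynomial would be [O(ln^(v-1) x)], against the lower bound
   [c ln^v x]. *)
Lemma rho_gt0 : (0 < v)%N -> 0 < rho R E.
Proof.
move=> v0; have [q qv [C C0 HC]] := Gcoprime_sum_poly v0.
have [c c0 [T0 HT]] := Gcoprime_sum_ge R edgeE.
set d := max_degree E in HC; have [D D0 HD] := @expr_le_expR R d.
rewrite ltNge -qv; apply/negP => qv0.
pose K : R := \sum_(j < v) `|q j|; have K0 : 0 <= K by apply: sumr_ge0.
(* The first three summands meet the thresholds of [HT] and [HC]; the last makes [c * T] exceed
   [K + C * D], the final contradiction. *)
pose T : R := `|T0| + 1 + 2 * d%:R + (K + C * D) / c.
have d0 : 0 <= 2 * d%:R :> R by rewrite mulr_ge0.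
have KC : 0 <= (K + C * D) / c by rewrite divr_ge0 ?addr_ge0 ?mulr_ge0 ?(ltW C0) ?(ltW D0) ?(ltW c0).
have T1 : 1 <= T by rewrite /T; have := normr_ge0 T0; lra.
have Tp : 0 < T by lra.
have lx : ln (expR T) = T by rewrite expRK.
have h1 : c * T ^+ v <= Gcoprime_sum E (expR T).
  rewrite -{1}lx; apply: HT; rewrite lx /T; have := ler_norm T0; lra.
have := HC (expR T); rewrite lx => /(_ T1) h2.
have {h2} : Gcoprime_sum E (expR T) - (\poly_(j < v.+1) q j).[T] <=
    C * ((expR T)^-1 * T ^+ (v + d - 1)).
  by apply: le_trans (ler_norm _) (h2 _); rewrite /T; have := normr_ge0 T0; lra.
have := poly_le_expr T1 v0 qv0; rewrite -/K => h3 h4.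
(* The excess [T ^+ d] is absorbed by the exponential, so the error has the same order as the lower
   terms of the polynomial. *)
have h5 : (expR T)^-1 * T ^+ (v + d - 1) <= D * T ^+ v.-1.
  have -> : (v + d - 1 = d + v.-1)%N by case: (v) v0 => // w _; rewrite addSn subn1 addnC.
  rewrite exprD mulrA ler_wpM2r ?exprn_ge0 ?(ltW Tp) //.
  rewrite mulrC ler_pdivrMr ?expR_gt0 //.
  apply: le_trans (_ : (1 + T) ^+ d <= _); first by rewrite lerXn2r ?nnegrE //; lra.
  apply: le_trans (HD T (ltW Tp)) _; rewrite ler_pM2l // ler_expR; lra.
have h6 : c * T ^+ v <= (K + C * D) * T ^+ v.-1.
  apply: le_trans h1 _; rewrite mulrDl -[C * D * _]mulrA -lerBlDl.
  have := ler_wpM2l (ltW C0) h5; move: h3 h4.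
  move: (Gcoprime_sum _ _) (_.[T]) (K * _) (C * _) (C * _) => a b e f h; lra.
move: h6; rewrite -{1}(prednK v0) exprS mulrA ler_pM2r ?exprn_gt0 // leNgt.
rewrite [c * T]mulrC -ltr_pdivrMr // /T; have := normr_ge0 T0.
by move: (_ / c) => z; lra.
Qed.

End Assembly.

Theorem theorem2p1 (R : realType) (v : nat) (E : {set 'I_v * 'I_v})
    (v_ge2 : (2 <= v)%N) (edgeE : is_edge_set E) (E_ge1 : (1 <= #|E|)%N) :
  exists P : {poly R},
    [/\ size P = v.+1,
        lead_coef P = rho R E,
        0 < rho R E &
        (fun x : R => Gcoprime_sum E x)
          = (fun x : R => P.[ln x])
            +O_ (+oo_R) (fun x : R => x^-1 * ln x ^+ (v + max_degree E - 1))].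
Proof.
have v0 : (0 < v)%N by apply: ltnW.
have rho0 := rho_gt0 R edgeE v0.
have [q qv [C C0 HC]] := Gcoprime_sum_poly R edgeE v0.
exists (\poly_(j < v.+1) q j); split => //.
(* Positivity of [rho] is what makes the degree exactly [v]. *)
- by rewrite size_poly_eq // qv gt_eqF.
- by rewrite lead_coef_poly // qv gt_eqF.
apply/eqaddOP; near=> k.
have Ck : C <= k by near: k; apply: nbhs_pinfty_ge; apply: num_real.
near=> x.
have x0 : 0 < x by near: x; exact: nbhs_pinfty_gt.
(* This turns the thresholds on [ln x] into conditions holding for all large [x]. *)
have xT (t : R) : expR t <= x -> t <= ln x.
  by move=> tx; rewrite -(expRK t) ler_ln ?posrE ?expR_gt0.
apply: le_trans (HC x _ _) _.
- by apply: xT; near: x; exact: nbhs_pinfty_ge.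
- by apply: xT; near: x; exact: nbhs_pinfty_ge.
apply: ler_pM; [exact: ltW| |exact: Ck|exact: ler_norm].
rewrite mulr_ge0 ?invr_ge0 ?(ltW x0) // exprn_ge0 //; apply: xT.
by near: x; exact: nbhs_pinfty_ge.
Unshelve. all: by end_near.
Qed.
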